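(* Let $H$ be a Krull monoid with free abelian class group $G$ of rank $r\ge3$ and let $G_{\mathcal P}\subset G$ denote the set of classes containing prime divisors. Suppose that there is a basis $(e_1,\dots,e_r)$ of $G$ such that $G_{\mathcal P}\setminus\{0\}=(G_{\mathcal P}^+\cup G_{\mathcal P}^-)\setminus\{0\}$, where $G_{\mathcal P}^+=\{\epsilon_1e_1+\dots+\epsilon_re_r:\epsilon_1,\dots,\epsilon_r\in\{0,1\}\}$ and $G_{\mathcal P}^-=-G_{\mathcal P}^+$. Then: (1) $\mathsf F_{r+2}\le\mathsf D(G_{\mathcal P})$. (2) $\mathsf c(H)\le\omega(H)=\mathsf D(G_{\mathcal P})$, $\rho(H)=\mathsf D(G_{\mathcal P})/2$, and $\rho_{2k}(H)=k\,\mathsf D(G_{\mathcal P})$ for each $k\in\mathbb N$. (3) $[1,2r-3]\subset\Delta^*(H)\subset\Delta(H)\subset[1,\mathsf c(H)-2]$.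
   Context: $\mathsf F_n$ is the $n$th Fibonacci number: $\mathsf F_0=0$, $\mathsf F_1=1$, $\mathsf F_n=\mathsf F_{n-1}+\mathsf F_{n-2}$. $[a,b]$ denotes the set of integers $x$ with $a\le x\le b$. Monoids are commutative, cancellative, with identity. A divisor theory of $H$ is a homomorphism $\varphi:H\to\mathcal F(\mathcal P)$ into a free abelian monoid with basis $\mathcal P$ such that $\varphi(a)\mid\varphi(b)$ implies $a\mid b$ and every $a\in\mathcal F(\mathcal P)$ is the gcd of $\varphi(X)$ for some finite nonempty $X\subset H$. $H$ is Krull if it has a divisor theory (unique up to isomorphism); its class group is $G=\mathsf q(\mathcal F(\mathcal P))/\mathsf q(\varphi(H))$ (additive), and $G_{\mathcal P}=\{[p]:p\in\mathcal P\}$ is the set of classes containing prime divisors. For a subset $G_0$ of an abelian group, $\mathcal B(G_0)$ is the monoid of zero-sum sequences over $G_0$, i.e. of those elements $g_1\cdots g_l$ of the free abelian monoid on $G_0$ with $g_1+\dots+g_l=0$; $\mathsf D(G_0)$ is the supremum of the lengths $l$ of its atoms (minimal zero-sum sequences). Factorizations: $\mathsf Z(H)$ is the free abelian monoid on the atoms of $H_{\rm red}=H/H^\times$, $\mathsf Z(a)$ the set of factorizations of $a$, $\mathsf L(a)=\{|z|:z\in\mathsf Z(a)\}$, $\mathcal L(H)=\{\mathsf L(a):a\in H\}$. $\Delta(L)$ is the set of differences of consecutive elements of $L\subset\mathbb Z$; $\Delta(H)=\bigcup_{L\in\mathcal L(H)}\Delta(L)$; $\Delta^*(H)$ is the set of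 all $\min\Delta(S)$ where $S\subset H$ is a divisor-closed submonoid (i.e. divisors in $H$ of elements of $S$ lie in $S$) with $\Delta(S)\ne\emptyset$. $\rho_k(H)$ is the supremum of the union of all $L\in\mathcal L(H)$ with $k\in L$; $\rho(H)=\sup\{\sup L/\min L:L\in\mathcal L(H),L\ne\{0\}\}$. For $z,z'\in\mathsf Z(H)$ with $g=\gcd(z,z')$, $\mathsf d(z,z')=\max\{|zg^{-1}|,|z'g^{-1}|\}$; $\mathsf c(H)$ is the smallest $N\in\mathbb N_0\cup\{\infty\}$ such that for all $a\in H$ any two $z,z'\in\mathsf Z(a)$ can be joined by a sequence in $\mathsf Z(a)$ whose consecutive members have distance at most $N$. For an atom $u$, $\omega(H,u)$ is the smallest $N$ such that whenever $u\mid v_1\cdots v_n$ with atoms $v_i$, there is $\Omega\subset[1,n]$ with $|\Omega|\le N$ and $u\mid\prod_{\nu\in\Omega}v_\nu$; $\omega(H)=\sup_u\omega(H,u)$. *)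

(* Defs.v *)
From HB Require Import structures.
From mathcomp Require Import all_boot all_order all_algebra.
From mathcomp Require Import finmap multiset.
From mathcomp.multinomials Require Import freeg.
From mathcomp Require Import all_classical all_reals ereal.

Set Implicit Arguments.
Unset Strict Implicit.
Unset Printing Implicit Defensive.

Import Order.TTheory GRing.Theory Num.Theory.

Local Open Scope quotient_scope.
Local Open Scope mset_scope.
Local Open Scope classical_set_scope.
Local Open Scope group_scope.

HB.mixin Record Monoid_isComCancel M of monoid.Monoid M := {
  ccmulC : commutative (@monoid.mul M);
  ccmulI : left_injective (@monoid.mul M)
}.

#[short(type="ccMonoidType")]
HB.structure Definition ComCancelMonoid :=
  {M of Monoid_isComCancel M & monoid.Monoid M}.

HB.instance Definition _ (M : ccMonoidType) :=
  SemiGroup.isCommutativeLaw.Build M (@monoid.mul M) ccmulC.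

(** The free abelian monoid with basis [P] is [{mset P}]: multiplication is
    [msetD], gcd is [msetI], length is [size]. *)

Section FreeMonoid.
Variable P : choiceType.

Fact msetDI : left_injective (@msetD P).
Proof.
move=> C A B /msetP eqAB; apply/msetP => x.
by have := eqAB x; rewrite !msetE2 => /addIn.
Qed.

Fact perm_msetD (y z : {mset P}) :
  perm_eq (y `+` z)%mset (enum_mset y ++ enum_mset z).
Proof.
by apply/allP=> x _ /=; rewrite count_cat !count_mem_mset msetE2.
Qed.

HB.instance Definition _ := Choice.on {mset P}.
HB.instance Definition _ :=
  isMonoid.Build {mset P} (@msetDA P) (@mset0D P) (@msetD0 P).
HB.instance Definition _ :=
  Monoid_isComCancel.Build {mset P} (@msetDC P) msetDI.

End FreeMonoid.

Section Submonoid.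
Variables (M : ccMonoidType) (S : umagmaClosed M).

Record submonoid := Submonoid {submonoid_val : M; _ : submonoid_val \in S}.

HB.instance Definition _ := [isSub for submonoid_val].
HB.instance Definition _ := [Choice of submonoid by <:].
Fact submonoid_closed : monoid_closed S.
Proof. by split; [exact: gpred1 | exact: gpredM]. Qed.
HB.instance Definition _ :=
  SubChoice_isSubMonoid.Build M _ submonoid submonoid_closed.

Fact submonoid_mulC : commutative (@monoid.mul submonoid).
Proof. by move=> a b; apply: val_inj; rewrite !valM ccmulC. Qed.
Fact submonoid_mulI : left_injective (@monoid.mul submonoid).
Proof.
move=> c a b /(congr1 val); rewrite !valM => /ccmulI; exact: val_inj.
Qed.
HB.instance Definition _ :=
  Monoid_isComCancel.Build submonoid submonoid_mulC submonoid_mulI.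

End Submonoid.

Section Divisibility.
Variable M : ccMonoidType.
Implicit Types a b u : M.

Definition mdvd a b := exists c, b = a * c.
Definition munit a := exists b, a * b = 1.
Definition atom u :=
  ~ munit u /\ forall a b, u = a * b -> munit a \/ munit b.
Definition mgcd (X : set M) a :=
  (forall x, X x -> mdvd a x) /\
  (forall b, (forall x, X x -> mdvd b x) -> mdvd b a).
Definition divisor_closed (S : {pred M}) :=
  forall a b, b \in S -> mdvd a b -> a \in S.

Definition associated a b := `[< exists2 e, munit e & b = a * e >].

Fact munit1 : munit (1 : M). Proof. by exists 1; rewrite mulg1. Qed.
Fact munitM a b : munit a -> munit b -> munit (a * b).
Proof.
move=> [a' aa'] [b' bb']; exists (b' * a').
by rewrite mulgA -(mulgA a) bb' mulg1.
Qed.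

Fact associated_equiv : equiv_class_of associated.
Proof.
have sym a b : associated a b -> associated b a.
  move=> /asboolP[e [f ef] ->]; apply/asboolP; exists f.
    by exists e; rewrite ccmulC.
  by rewrite -mulgA ef mulg1.
split=> [a|a b|b a c].
- by apply/asboolP; exists 1; [exact: munit1 | rewrite mulg1].
- by apply/idP/idP; apply: sym.
- move=> /asboolP[e ue ->] /asboolP[f uf ->]; apply/asboolP.
  by exists (e * f); [exact: munitM | rewrite mulgA].
Qed.

Canonical associated_equivRel := EquivRelPack associated_equiv.
Canonical associated_encModRel := defaultEncModRel associated.

Definition red := {eq_quot associated}.
HB.instance Definition _ : EqQuotient M associated red := EqQuotient.on red.
HB.instance Definition _ := Choice.on red.

Definition red_one : red := \pi_red 1.
Definition red_mul (x y : red) : red := \pi_red (repr x * repr y).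

Fact pi_red_mul a b : red_mul (\pi_red a) (\pi_red b) = \pi_red (a * b).
Proof.
rewrite /red_mul; apply/eqmodP/asboolP.
have /eqmodP/asboolP[e ue aE] : repr (\pi_red a) = a %[mod red].
  by rewrite reprK.
have /eqmodP/asboolP[f uf bE] : repr (\pi_red b) = b %[mod red].
  by rewrite reprK.
exists (e * f); first exact: munitM.
rewrite [in LHS]aE [in LHS]bE -!mulgA; congr (_ * _).
by rewrite !mulgA (ccmulC e).
Qed.

Fact red_mulA : associative red_mul.
Proof.
elim/quotW=> a; elim/quotW=> b; elim/quotW=> c.
by rewrite (pi_red_mul b c) (pi_red_mul a b) !pi_red_mul mulgA.
Qed.
Fact red_mul1 : left_id red_one red_mul.
Proof. by elim/quotW=> a; rewrite pi_red_mul mul1g. Qed.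
Fact red_mulC : commutative red_mul.
Proof. by elim/quotW=> a; elim/quotW=> b; rewrite !pi_red_mul ccmulC. Qed.
Fact red_mul1r : right_id red_one red_mul.
Proof. by move=> x; rewrite red_mulC red_mul1. Qed.
Fact red_mulI : left_injective red_mul.
Proof.
elim/quotW=> c; elim/quotW=> a; elim/quotW=> b; rewrite !pi_red_mul.
move=> /eqmodP/asboolP[e ue eqab]; apply/eqmodP/asboolP; exists e => //.
by apply: (@ccmulI _ c); rewrite eqab -!mulgA (ccmulC e).
Qed.

HB.instance Definition _ := isMonoid.Build red red_mulA red_mul1 red_mul1r.
HB.instance Definition _ := Monoid_isComCancel.Build red red_mulC red_mulI.

End Divisibility.

(** Supremum in the interval from 0 to +oo; [ereal_sup set0] is -oo. *)
Definition esup0 {R : realType} (A : set (\bar R)) : \bar R :=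
  ereal_sup (0%E |` A).

Definition nat_ereal (R : realType) (n : nat) : \bar R := (n%:R)%:E.

Definition set_min (A : set nat) (m : nat) :=
  A m /\ forall n, A n -> (m <= n)%N.

Definition set_Delta (L : set nat) : set nat :=
  [set d | exists k l, [/\ L k, L l, (k < l)%N, d = (l - k)%N &
             forall m, L m -> ~~ (k < m < l)%N]].

Section Factorizations.
Variable M : ccMonoidType.

Definition red_atom := {u : red M | `[< atom u >]}.
HB.instance Definition _ := Choice.on red_atom.
Implicit Types z : {mset red_atom}.

Definition factorizations (a : M) : set {mset red_atom} :=
  [set z : {mset red_atom} | \prod_(u <- z) val u = \pi_(red M) a].

Definition lengths (a : M) : set nat := [set size z | z in factorizations a].

Definition lengths_system : set (set nat) := [set lengths a | a in setT].

Definition Delta : set nat := \bigcup_(A in lengths_system) set_Delta A.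

Definition fdist z z' : nat :=
  maxn (size (z `\` (z `&` z'))%mset) (size (z' `\` (z `&` z'))%mset).

Definition chain_bound (N : nat) :=
  forall (a : M) z z', factorizations a z -> factorizations a z' ->
  exists s : seq {mset red_atom},
    [/\ forall y, y \in s -> factorizations a y, last z s = z' &
        path (fun x y => fdist x y <= N)%N z s].

Definition omega_bound (u : M) (N : nat) :=
  forall (n : nat) (v : 'I_n -> M), (forall i, atom (v i)) ->
  mdvd u (\prod_(i < n) v i) ->
  exists2 Omega : {set 'I_n}, (#|Omega| <= N)%N &
    mdvd u (\prod_(i in Omega) v i).

Variable R : realType.

Definition catenary_degree : \bar R :=
  ereal_inf [set nat_ereal R N | N in chain_bound].

Definition omega_at (u : M) : \bar R :=
  ereal_inf [set nat_ereal R N | N in omega_bound u].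

Definition omega : \bar R := esup0 [set omega_at u | u in @atom M].

Definition rho_k (k : nat) : \bar R :=
  esup0 [set nat_ereal R l |
           l in \bigcup_(A in [set A | lengths_system A /\ A k]) A].

Definition elasticity : \bar R :=
  esup0 [set x | exists (A : set nat) (m : nat),
           [/\ lengths_system A, A <> [set 0%N], set_min A m &
               x = (esup0 [set nat_ereal R l | l in A] * (m%:R^-1)%:E)%E]].

End Factorizations.

Definition Delta_star (M : ccMonoidType) : set nat :=
  [set d | exists S : umagmaClosed M,
             divisor_closed S /\ set_min (Delta (submonoid S)) d].

Section BlockMonoid.
Variables (G : zmodType) (G0 : set G).

Definition zero_sum : {pred {mset G}} :=
  fun z => `[< (forall g, g \in z -> G0 g) /\ (\sum_(g <- z) g = 0)%R >].

Fact zero_sum1 : 1 \in zero_sum.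
Proof.
by apply/asboolP; split=> [g|]; rewrite ?big_mset0 // in_mset0.
Qed.
Fact zero_sumM : mulg_closed zero_sum.
Proof.
move=> y z /asboolP[y0 sy] /asboolP[z0 sz]; apply/asboolP; split=> [g|].
  by rewrite in_msetD => /orP[/y0|/z0].
by rewrite (perm_big _ (perm_msetD y z)) big_cat /= sy sz addr0.
Qed.
HB.instance Definition _ := isMulClosed.Build {mset G} zero_sum zero_sumM.
HB.instance Definition _ := isMul1Closed.Build {mset G} zero_sum zero_sum1.

Definition block_monoid := @submonoid {mset G} zero_sum.
HB.instance Definition _ := ComCancelMonoid.on block_monoid.

Definition davenport (R : realType) : \bar R :=
  esup0 [set nat_ereal R (size (submonoid_val U : {mset G})) | U in @atom block_monoid].

End BlockMonoid.

Section DivisorTheory.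
Variables (H : ccMonoidType) (P : choiceType).
Variable phi : UMagmaMorphism.type H {mset P}.

Definition divisor_theory :=
  (forall a b, mdvd (phi a) (phi b) -> mdvd a b) /\
  (forall z : {mset P}, exists X : set H,
     [/\ finite_set X, X !=set0 & mgcd (phi @` X) z]).

(** [{freeg P / int}] is the quotient group of [{mset P}], into which
    [mset_freeg] embeds the latter; [principal] is the image of the quotient
    group of [H]. *)
Definition mset_freeg (z : {mset P}) : {freeg P / int} :=
  (\sum_(p <- z) << p >>)%R.

Definition principal : {pred {freeg P / int}} :=
  fun x => `[< exists a b, x = (mset_freeg (phi a) - mset_freeg (phi b))%R >].

Fact principal_closed : zmod_closed principal.
Proof.
have freegD y z : mset_freeg (y `+` z)%mset = (mset_freeg y + mset_freeg z)%R.
  by rewrite /mset_freeg (perm_big _ (perm_msetD y z)) big_cat.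
split=> [|x y /asboolP[a [b ->]] /asboolP[c [d ->]]]; apply/asboolP.
  by exists 1, 1; rewrite subrr.
exists (a * d), (b * c); rewrite !gmulfM !freegD.
by rewrite opprB addrACA -opprD.
Qed.
HB.instance Definition _ :=
  GRing.isZmodClosed.Build _ principal principal_closed.

Definition class_group := Quotient.quot principal.
HB.instance Definition _ := GRing.Zmodule.on class_group.

Definition prime_class (p : P) : class_group := \pi_class_group << p >>.

Definition prime_classes : set class_group := range prime_class.

End DivisorTheory.

Arguments prime_classes {H P} phi _.

Section Basis.
Variables (G : zmodType) (r : nat) (e : 'I_r -> G).

Definition zbasis :=
  forall g, exists! c : {ffun 'I_r -> int}, g = (\sum_i e i *~ c i)%R.

Definition Gplus : set G :=
  [set g | exists eps : 'I_r -> bool, g = (\sum_i e i *+ eps i)%R].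

Definition Gminus : set G := [set (- g)%R | g in Gplus].

End Basis.

Fixpoint fib (n : nat) : nat :=
  match n with
  | 0 => 0
  | 1 => 1
  | (m.+1 as k).+1 => fib k + fib m
  end.

(* Main.v *)
(* Through [phi], the monoid [H] is, up to units, the monoid of multisets of
   primes whose classes sum to zero, and its atoms are those whose sequence of
   classes is a minimal zero-sum sequence.

   An atom with [l] primes divides a product of atoms as soon as it divides a
   product of [l] of them; pairing each prime with one of the opposite class
   shows that [l] is optimal when [l > 2].  This gives [omega = D]; an induction
   on the number of primes gives [c <= D], and [U (-U)] gives the elasticities.

   The two constructions over the 0-1 vectors are circuits, that is, families
   [v_0, ..., v_n] whose integer relations are the multiples of one positive
   vector [c] with [c_0 = 1].  Then [v_0^c_0 ... v_n^c_n] is an atom, and the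
   set of lengths over the classes [+-v_j] has minimal distance
   [c_0 + ... + c_n - 2].  With [c_j = F_j] for [j > 0] the length of this atom
   is [F_(r+2)]; with [c = (1, ..., 1, k)] all distances up to [2 r - 3] occur. *)

Require Import Defs.
From HB Require Import structures.
From mathcomp Require Import all_boot all_order all_algebra.
From mathcomp Require Import finmap multiset.
From mathcomp.multinomials Require Import freeg.
From mathcomp Require Import all_classical all_reals ereal.
From mathcomp Require Import zify.

Set Implicit Arguments.
Unset Strict Implicit.
Unset Printing Implicit Defensive.

Import Order.TTheory GRing.Theory Num.Theory.

Local Open Scope quotient_scope.
Local Open Scope mset_scope.
Local Open Scope classical_set_scope.
Local Open Scope group_scope.

(** * Factorizations in cancellative monoids *)

Lemma size_msetD (K : choiceType) (A B : {mset K}) :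
  size (A `+` B)%mset = (size A + size B)%N.
Proof. by rewrite (perm_size (perm_msetD A B)) size_cat. Qed.

Lemma mset_dvdP (K : choiceType) (A B : {mset K}) :
  mdvd A B <-> (A `<=` B)%mset.
Proof.
split=> [[C ->]|AB]; first by apply/msubsetP => x; rewrite msetE2 leq_addr.
by exists (B `\` A)%mset; rewrite [RHS]msetBDKC.
Qed.

(** * Units, atoms and lengths modulo units *)

Section Reduced.
Variable M : ccMonoidType.
Implicit Types a b u : M.

Lemma munitMl a b : munit (a * b) -> munit a.
Proof. by move=> [c abc]; exists (b * c); rewrite mulgA. Qed.

Lemma mdvd_prod (s : seq M) u : u \in s -> mdvd u (\prod_(v <- s) v).
Proof.
by move=> us; exists (\prod_(v <- rem u s) v); rewrite (perm_big _ (perm_to_rem us)) big_cons.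
Qed.

Lemma pi_redP a b :
  \pi_(red M) a = \pi_(red M) b <-> exists2 e, munit e & b = a * e.
Proof.
split=> [/eqmodP/asboolP //|h]; apply/eqmodP/asboolP; exact: h.
Qed.

Lemma pi_redM a b : \pi_(red M) (a * b) = \pi_(red M) a * \pi_(red M) b.
Proof. by rewrite -pi_red_mul. Qed.

Lemma pi_red_prod I (s : seq I) (F : I -> M) :
  \pi_(red M) (\prod_(i <- s) F i) = \prod_(i <- s) \pi_(red M) (F i).
Proof. exact: (big_morph _ pi_redM). Qed.

Lemma munit_pi a : munit (\pi_(red M) a) <-> munit a.
Proof.
split=> [[x]|[b ab]].
  elim/quotW: x => b; rewrite -pi_redM => /esym/pi_redP [e ue] /=.
  by rewrite mul1g => abe; apply: (@munitMl a b); rewrite abe.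
by exists (\pi_(red M) b); rewrite -pi_redM ab.
Qed.

Lemma atom_pi u : atom (\pi_(red M) u) <-> atom u.
Proof.
split=> -[nu ua]; split; do ?by rewrite munit_pi in nu *.
  move=> a b uab; have := ua (\pi_(red M) a) (\pi_(red M) b).
  by rewrite -pi_redM uab !munit_pi; exact.
move=> x y; elim/quotW: x => a; elim/quotW: y => b.
rewrite -pi_redM => /pi_redP[e ue]; case: (ue) => f ef.
move=> abE; have uE : u = a * (b * f).
  by rewrite mulgA abE -mulgA ef mulg1.
by case: (ua _ _ uE) => [?|/munitMl ?]; [left|right]; apply/munit_pi.
Qed.

Lemma red_atomP (x : red_atom M) : atom (val x).
Proof. exact/asboolP/(valP x). Qed.

(** Replaces multisets over a subtype of a quotient by plain lists of atoms of [M]; the price is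
    that the product is controlled only up to a unit. *)
Lemma lengthsP a n : lengths a n <->
  exists s : seq M, [/\ {in s, forall u, atom u}, size s = n &
    \pi_(red M) (\prod_(u <- s) u) = \pi_(red M) a].
Proof.
split=> [[z za <-]|[s [sat <- sa]]].
  exists [seq repr (val x) | x <- enum_mset z]; split; last 2 first.
  - by rewrite size_map.
  - rewrite -za pi_red_prod big_map; apply: eq_bigr => x _.
    by rewrite reprK.
  - move=> _ /mapP[x _ ->]; apply/atom_pi; rewrite reprK; exact: red_atomP.
suff [z zs <-] : exists2 z : {mset red_atom M},
   \prod_(x <- z) val x = \pi_(red M) (\prod_(u <- s) u) & size z = size s.
  by exists z => //; rewrite /factorizations /= zs sa.
elim: s sat {sa} => [|u s IHs] sat.
  by exists mset0; rewrite ?enum_mset0 ?size_mset0 // !big_nil.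
have [|z zs zn] := IHs.
  by move=> v vs; apply: sat; rewrite inE vs orbT.
have ua : `[< atom (\pi_(red M) u) >].
  by apply/asboolP/atom_pi/sat; rewrite mem_head.
exists ([mset (exist (fun v : red M => `[< atom v >] : Prop) _ ua : red_atom M)] `+` z)%mset.
  rewrite (perm_big _ (perm_msetD _ _)) big_cat /= enum_msetn big_seq1 /=.
  by rewrite zs big_cons pi_redM.
by rewrite size_msetD enum_msetn /= zn.
Qed.

Lemma lengths_eq a b : \pi_(red M) a = \pi_(red M) b -> lengths a = lengths b.
Proof. by rewrite /lengths /factorizations => ->. Qed.

End Reduced.

(** * Divisor-closed submonoids *)

Section DivisorClosed.
Variables (M : ccMonoidType) (S : umagmaClosed M).
Hypothesis Sdiv : divisor_closed S.
Implicit Types a b u : submonoid S.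

Lemma munit_val a : munit a <-> munit (val a).
Proof.
split=> [[b /(congr1 val)]|[b ab]]; first by rewrite valM => ?; exists (val b).
have Sb : b \in S.
  apply: (Sdiv (b := 1)); [exact: gpred1|].
  by exists (val a); rewrite ccmulC ab.
by exists (Submonoid Sb); apply: val_inj; rewrite valM.
Qed.

Lemma atom_val u : atom u <-> atom (val u).
Proof.
split=> -[nu ua]; split; do ?by rewrite munit_val in nu *.
  move=> a b uab.
  have Sa : a \in S by apply: (Sdiv (valP u)); exists b.
  have Sb : b \in S by apply: (Sdiv (valP u)); exists a; rewrite ccmulC.
  have := ua (Submonoid Sa) (Submonoid Sb); rewrite !munit_val; apply.
  by apply: val_inj; rewrite valM.
move=> a b uab; rewrite !munit_val; apply: ua; by rewrite uab valM.
Qed.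

Lemma val_prod (s : seq (submonoid S)) :
  val (\prod_(u <- s) u) = \prod_(u <- s) val u.
Proof. by apply: (big_morph _ (id1 := 1) (op1 := *%g)) => // a b; rewrite valM. Qed.

Lemma pi_red_val a b :
  \pi_(red (submonoid S)) a = \pi_(red (submonoid S)) b <->
  \pi_(red M) (val a) = \pi_(red M) (val b).
Proof.
split=> /pi_redP[e ue bE]; apply/pi_redP.
  by exists (val e); [apply/munit_val | rewrite bE valM].
have Se : e \in S.
  by apply: (Sdiv (valP b)); exists (val a); rewrite bE ccmulC.
exists (Submonoid Se); first exact/munit_val.
by apply: val_inj; rewrite valM.
Qed.

(** Every atom in a factorization of [val a] divides it, hence lies in [S]; units and atoms of [S]
    are those of [M] by [munit_val] and [atom_val]. *)
Lemma lengths_val a : lengths a = lengths (val a).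
Proof.
apply/seteqP; split=> n /lengthsP[s [sat sn sa]]; apply/lengthsP.
  exists (map val s); split; last 2 first.
  - by rewrite size_map.
  - by rewrite big_map -val_prod; apply/pi_red_val.
  - by move=> _ /mapP[u us ->]; apply/atom_val/sat.
have sS : {in s, forall x, x \in S}.
  move=> u us; apply: (Sdiv (valP a)).
  have /pi_redP[e _ ->] := sa; have [c ->] := mdvd_prod us.
  by exists (c * e); rewrite mulgA.
have {sS} [s' sE] : exists s' : seq (submonoid S), map val s' = s.
  elim: s sS {sat sn sa} => [|u s IHs] sS; first by exists [::].
  have [|s' <-] := IHs; first by move=> v vs; apply: sS; rewrite inE vs orbT.
  by exists (Submonoid (sS u (mem_head _ _)) :: s').
exists s'; split.
- by move=> u us; apply/atom_val/sat; rewrite -sE map_f.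
- by rewrite -sn -sE size_map.
- by apply/pi_red_val; rewrite val_prod -(big_map val xpredT id) sE.
Qed.

Lemma Delta_submonoid : Delta (submonoid S) `<=` Delta M.
Proof.
move=> d [A [a _ <-]] dA; exists (lengths (val a)); first by exists (val a).
by rewrite -lengths_val.
Qed.

End DivisorClosed.

Lemma Delta_star_Delta (M : ccMonoidType) : Delta_star M `<=` Delta M.
Proof. by move=> d [S [Sdiv [+ _]]]; exact: Delta_submonoid. Qed.

(** A discrete intermediate value argument: since no value of [f] falls strictly between [k] and
    [l], some single step jumps over the whole gap. *)
Lemma path_crossing (T : eqType) (f : T -> nat) (e : rel T) k l z s :
  path e z s -> (f z <= k)%N -> (l <= f (last z s))%N -> (k < l)%N ->
  {in s, forall y, (f y <= k)%N || (l <= f y)%N} ->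
  exists x y, [/\ x \in z :: s, y \in s, e x y, (f x <= k)%N & (l <= f y)%N].
Proof.
elim: s z => [|y s IHs] z /=; first by lia.
move=> /andP[ezy ys] fz fl kl H.
have [fy|fy] := boolP (l <= f y)%N.
  by exists z, y; rewrite !mem_head.
have fyk : (f y <= k)%N by have := H y (mem_head _ _); lia.
have [|x' [y' [xs' ys' exy fx' fy']]] // := IHs y ys fyk fl kl.
  by move=> w ws; apply: H; rewrite inE ws orbT.
by exists x', y'; split=> //; rewrite inE ?xs' ?ys' orbT.
Qed.

(** * Distances between factorizations of different lengths *)

Section Distance.
Variable M : ccMonoidType.
Implicit Types z : {mset red_atom M}.

Definition atoms_prod z : red M := \prod_(u <- z) val u.

Lemma atoms_prodD z z' : atoms_prod (z `+` z')%mset = atoms_prod z * atoms_prod z'.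
Proof. by rewrite /atoms_prod (perm_big _ (perm_msetD _ _)) big_cat. Qed.

Lemma atoms_prod0 : atoms_prod mset0 = 1.
Proof. by rewrite /atoms_prod enum_mset0 big_nil. Qed.

Lemma atoms_prod1 u : atoms_prod [mset u]%mset = val u.
Proof. by rewrite /atoms_prod enum_msetn big_seq1. Qed.

Lemma atoms_prod_munit z : munit (atoms_prod z) -> z = mset0.
Proof.
case: (mset_0Vmem z) => [//|[u uz]].
rewrite -(msetB1K uz) atoms_prodD atoms_prod1 => /munitMl.
by case: (red_atomP u).
Qed.

Lemma atoms_prod_atom z : atom (atoms_prod z) -> size z = 1%N.
Proof.
case: (mset_0Vmem z) => [->|[u uz]].
  by rewrite atoms_prod0 => -[]; case; exact: munit1.
rewrite -(msetB1K uz) atoms_prodD atoms_prod1 => -[_ /(_ _ _ erefl)] [].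
  by case: (red_atomP u).
by move/atoms_prod_munit->; rewrite msetD0 enum_msetn.
Qed.

Lemma fdistD y z z' : fdist (y `+` z)%mset (y `+` z')%mset = fdist z z'.
Proof. by rewrite /fdist -!msetDIr !msetBDl. Qed.

(* After cancelling the common part, the shorter factorization still has at
   least two atoms, since an atom has no other factorization. *)
Lemma fdist_size z z' : atoms_prod z = atoms_prod z' -> (size z < size z')%N ->
  (size z' - size z + 2 <= fdist z z')%N.
Proof.
set g := (z `&` z')%mset; set x := (z `\` g)%mset; set y := (z' `\` g)%mset.
have zE : z = (x `+` g)%mset by rewrite [RHS]msetBDK // msubsetIl.
have z'E : z' = (y `+` g)%mset by rewrite [RHS]msetBDK // msubsetIr.
have sz : size z = (size x + size g)%N by rewrite -size_msetD -zE.
have sz' : size z' = (size y + size g)%N by rewrite -size_msetD -z'E.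
have -> : atoms_prod z = atoms_prod x * atoms_prod g by rewrite -atoms_prodD -zE.
have -> : atoms_prod z' = atoms_prod y * atoms_prod g by rewrite -atoms_prodD -z'E.
move=> /ccmulI xy; rewrite sz sz'.
have -> : fdist z z' = maxn (size x) (size y) by [].
suff : (1 < size x)%N || (size y == size x) by lia.
have [sx|] := boolP (1 < size x)%N; first by [].
case sx: (size x) => [|[|n]] // _ /=.
  have /eqP x0 : x == mset0 by rewrite -size_mset_eq0 sx.
  have -> : y = mset0; last by rewrite size_mset0.
  by apply: atoms_prod_munit; rewrite -xy x0 atoms_prod0; exact: munit1.
case: (mset_0Vmem x) => [x0|[u ux]]; first by rewrite x0 size_mset0 in sx.
have xE := msetB1K ux; move: sx; rewrite -xE size_msetD enum_msetn /= => -[/eqP].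
rewrite size_mset_eq0 => /eqP xu0.
move: xy; rewrite -xE xu0 msetD0 atoms_prod1 => uy.
by apply/eqP/atoms_prod_atom; rewrite -uy; exact: red_atomP.
Qed.

(** A chain between factorizations of consecutive lengths [k] and [l] crosses the gap in one step,
    and by [fdist_size] that step has distance at least [d + 2]. This holds for every chain bound,
    hence for the infimum. *)
Lemma Delta_catenary (R : realType) d :
  Delta M d -> (1 <= d)%N /\ (nat_ereal R d <= catenary_degree M R - nat_ereal R 2)%E.
Proof.
move=> [_ [a _ <-] [k [l [[z za zk] [z' z'a z'l] kl dE gap]]]].
split; first by lia.
rewrite /nat_ereal leeBrDr // /catenary_degree; apply: le_ereal_inf_tmp => _ [N cN <-].
have [s [sa slast ps]] := cN _ _ _ za z'a.
have fa y : y \in z :: s -> factorizations a y.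
  by rewrite inE => /predU1P[->|/sa].
have [|||x [y [xs ys exy fx fy]]] := path_crossing (f := fun z => size z) ps _ _ kl.
- by rewrite zk.
- by rewrite slast z'l.
- by move=> y ys; have := gap _ (ex_intro2 _ _ y (sa y ys) erefl); lia.
have := fdist_size (z := x) (z' := y).
rewrite /atoms_prod (fa x xs) (sa y ys) => /(_ erefl) xy.
rewrite -EFinD lee_fin -natrD ler_nat.
by lia.
Qed.

End Distance.

(** * Monoids of zero-sum multisets *)

(** Lifts a rearrangement of the classes to a rearrangement of the primes. *)
Lemma perm_map_inv (T U : eqType) (f : T -> U) (s : seq T) (t : seq U) :
  perm_eq (map f s) t -> exists2 s', perm_eq s s' & map f s' = t.
Proof.
elim: t s => [|y t IHt] s.
  by move=> /perm_nilP; case: s => // _; exists [::].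
move=> st; have : y \in map f s by rewrite (perm_mem st) mem_head.
move=> /mapP[x xs yE]; have := perm_map f (perm_to_rem xs).
rewrite perm_sym /= -yE => /perm_trans/(_ st); rewrite perm_cons => /IHt[s' ss' <-].
exists (x :: s'); last by rewrite /= yE.
by apply: (perm_trans (perm_to_rem xs)); rewrite perm_cons.
Qed.

Lemma perm_mset_cat (K : choiceType) (A : {mset K}) (s t : seq K) :
  perm_eq A (s ++ t) -> A = (seq_mset s `+` seq_mset t)%mset.
Proof.
move=> /permP Ast; apply/msetP => x.
by rewrite msetE2 !mset_seqE -count_mem_mset Ast count_cat.
Qed.

Lemma count_msetD (K : choiceType) (a : pred K) (A B : {mset K}) :
  count a (A `+` B)%mset = (count a A + count a B)%N.
Proof. by rewrite (seq.permP (perm_msetD A B)) count_cat. Qed.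

Lemma count_msubset (K : choiceType) (a : pred K) (A B : {mset K}) :
  (A `<=` B)%mset -> (count a A <= count a B)%N.
Proof. by move=> /msetBDKC <-; rewrite count_msetD leq_addr. Qed.

Lemma count_prod_mset (K : choiceType) I (s : seq I) (F : I -> {mset K}) (a : pred K) :
  count a (\prod_(i <- s) F i : {mset K}) = (\sum_(i <- s) count a (F i))%N.
Proof.
apply: (big_morph (fun A : {mset K} => count a A)); first exact: count_msetD.
by rewrite enum_mset0.
Qed.

(** Greedy selection: [F t] is kept only if it meets what remains of [A], so each kept member
    removes at least one element of [A]. *)
Lemma mset_cover (K : choiceType) (T : eqType) (s : seq T) (F : T -> {mset K})
    (A : {mset K}) :
  (A `<=` \prod_(t <- s) F t)%mset ->
  exists s', [/\ subseq s' s, (size s' <= size A)%N &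
                 (A `<=` \prod_(t <- s') F t)%mset].
Proof.
elim: s A => [|t s IHs] A; first by exists [::]; split.
rewrite big_cons => Ats.
have [|s' [ss' s'A As']] := IHs (A `\` F t)%mset.
  by rewrite subset_msetBLR.
have AE : A = ((A `&` F t) `+` (A `\` F t))%mset.
  by apply/msetP => x; rewrite !msetE2; lia.
case: (mset_0Vmem (A `&` F t)%mset) => [AF0|[x xAF]].
  have AFE : (A `\` F t)%mset = A by rewrite {2}AE AF0 mset0D.
  exists s'; rewrite AFE in s'A As'; split=> //.
  by rewrite (subseq_trans ss' (subseq_cons _ _)).
exists (t :: s'); split.
- by rewrite /= eqxx.
- rewrite /= {1}AE size_msetD; have : (0 < size (A `&` F t)%mset)%N; last by lia.
  by rewrite lt0n size_mset_eq0; apply: contraTneq xAF => ->; rewrite in_mset0.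
- by rewrite big_cons -subset_msetBLR.
Qed.

(** * Minimal zero-sum sequences *)

Section MinZeroSum.
Variable G : zmodType.
Implicit Types s t : seq G.

Definition min_zero_sum s :=
  [/\ s <> [::], (\sum_(g <- s) g = 0)%R &
      forall s1 s2, perm_eq s (s1 ++ s2) -> (\sum_(g <- s1) g = 0)%R ->
        s1 = [::] \/ s2 = [::]].

Lemma perm_min_zero_sum s t : perm_eq s t -> min_zero_sum s -> min_zero_sum t.
Proof.
move=> st [s0 sum_s smin]; split.
- by move=> t0; apply: s0; apply/perm_nilP; rewrite -t0.
- by rewrite -(perm_big _ st).
- by move=> s1 s2 ts12; apply: smin; exact: perm_trans ts12.
Qed.

(** Up to order [s] is [t] followed by a complement, and minimality makes the complement empty. *)
Lemma min_zero_sum_sub s t : min_zero_sum s -> t <> [::] ->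
  (forall g, count_mem g t <= count_mem g s)%N -> (\sum_(g <- t) g = 0)%R ->
  perm_eq s t.
Proof.
move=> [_ _ smin] t0 /count_subseqP[t' /perm_to_subseq[s' ss'] tt'] sum_t.
have ts' : perm_eq s (t ++ s').
  by apply: (perm_trans ss'); rewrite perm_cat2r perm_sym.
by case: (smin _ _ ts' sum_t) => // s0; rewrite s0 cats0 in ts'.
Qed.

End MinZeroSum.

(* [phi] identifies the associate classes of [M] with the zero-sum multisets
   over [Q], where [p] is weighted by its class [cl p]. *)
Record zero_sum_model (M : ccMonoidType) (P : choiceType) (G : zmodType)
    (cl : P -> G) (Q : set P) (phi : M -> {mset P}) : Prop := ZeroSumModel {
  model1 : phi 1 = mset0;
  modelM : forall a b, phi (a * b) = (phi a `+` phi b)%mset;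
  model_dvd : forall a b, (phi a `<=` phi b)%mset -> mdvd a b;
  model_im : forall z : {mset P}, (exists a, phi a = z) <->
    (forall p, p \in z -> Q p) /\ (\sum_(p <- z) cl p = 0)%R }.

(** * Units, divisibility and atoms in a zero-sum model *)

Section Model.
Variables (M : ccMonoidType) (P : choiceType) (G : zmodType).
Variables (cl : P -> G) (Q : set P) (phi : M -> {mset P}).
Hypothesis phiP : zero_sum_model cl Q phi.
Implicit Types (a b u : M) (p : P).

Lemma model_prod I (s : seq I) (F : I -> M) :
  phi (\prod_(i <- s) F i) = \prod_(i <- s) phi (F i).
Proof. exact: (big_morph _ (modelM phiP) (model1 phiP)). Qed.

Lemma munit_phi a : munit a <-> phi a = mset0.
Proof.
split=> [[b /(congr1 phi)]|a0].
  rewrite (modelM phiP) (model1 phiP) => /msetP ab0; apply/msetP => p.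
  by have := ab0 p; rewrite msetE2 mset0E; lia.
have [|b bE] := model_dvd phiP (a := a) (b := 1); last by exists b.
by rewrite a0 msub0set.
Qed.

Lemma pi_phi a b : \pi_(red M) a = \pi_(red M) b <-> phi a = phi b.
Proof.
split=> [/pi_redP[e /munit_phi e0 ->]|ab].
  by rewrite (modelM phiP) e0 msetD0.
have [|e bE] := model_dvd phiP (a := a) (b := b); first by rewrite ab msubset_refl.
apply/pi_redP; exists e => //; apply/munit_phi.
have := modelM phiP a e; rewrite -bE -ab -[X in X = _]msetD0 => /esym.
by move=> /(congr1 (msetB^~ (phi a))); rewrite !msetDKB.
Qed.

Lemma phi_sum a : (\sum_(p <- phi a) cl p = 0)%R.
Proof. by have /(model_im phiP)[] : exists b, phi b = phi a by exists a. Qed.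

Lemma phi_supp a p : p \in phi a -> Q p.
Proof. by have /(model_im phiP)[+ _] : exists b, phi b = phi a; [exists a | apply]. Qed.

Lemma phi_dvd a b : mdvd a b <-> (phi a `<=` phi b)%mset.
Proof.
split=> [[c ->]|/(model_dvd phiP)//].
by apply/mset_dvdP; exists (phi c); rewrite (modelM phiP).
Qed.

(** A splitting of the class sequence into zero-sum parts lifts to a splitting of the primes of [u];
    both parts are in the image of [phi], which gives a factorization of [u] up to a unit. *)
Lemma atom_phi u : atom u <-> min_zero_sum (map cl (phi u)).
Proof.
split=> [[nu ua]|[u0 _ umin]].
  split.
  - move=> /(congr1 size); rewrite size_map => /eqP.
    by rewrite size_mset_eq0 => /eqP /munit_phi.
  - by rewrite big_map phi_sum.
  move=> s1 s2 /perm_map_inv[t ut tE] sum1.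
  have tE1 : map cl (take (size s1) t) = s1 by rewrite map_take tE take_size_cat.
  have tE2 : map cl (drop (size s1) t) = s2 by rewrite map_drop tE drop_size_cat.
  move: ut; rewrite -(cat_take_drop (size s1) t).
  move: (take _ t) (drop _ t) tE1 tE2 => t1 t2 tE1 tE2 ut {t tE}.
  have t1Q p : p \in t1 -> Q p.
    by move=> pt; apply: (@phi_supp u); rewrite (perm_mem ut) mem_cat pt.
  have t2Q p : p \in t2 -> Q p.
    by move=> pt; apply: (@phi_supp u); rewrite (perm_mem ut) mem_cat pt orbT.
  have im (t : seq P) : (forall p, p \in t -> Q p) -> (\sum_(p <- t) cl p = 0)%R ->
      exists a, phi a = seq_mset t.
    move=> tQ sum_t; apply/(model_im phiP); split.
      by move=> p; rewrite (perm_mem (perm_eq_seq_mset t)); exact: tQ.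
    by rewrite (perm_big _ (perm_eq_seq_mset t)).
  have sumt1 : (\sum_(p <- t1) cl p = 0)%R by rewrite -[RHS]sum1 -tE1 big_map.
  have sumt2 : (\sum_(p <- t2) cl p = 0)%R.
    by have := phi_sum u; rewrite (perm_big _ ut) big_cat /= sumt1 add0r.
  have [a aE] := im t1 t1Q sumt1; have [b bE] := im t2 t2Q sumt2.
  have nil0 (t : seq P) : seq_mset t = mset0 -> t = [::].
    move=> t0; apply/perm_nilP; have := perm_eq_seq_mset t.
    by rewrite t0 enum_mset0 perm_sym.
  have uE : \pi_(red M) (a * b) = \pi_(red M) u.
    by apply/pi_phi; rewrite (modelM phiP) aE bE; exact/esym/perm_mset_cat.
  (* The unit [f] by which [a * b] differs from [u] is absorbed into the second factor. *)
  move: uE => /pi_redP[f uf fE]; have := ua a (b * f).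
  rewrite mulgA -fE => /(_ erefl)[|/munitMl] /munit_phi.
    by rewrite aE => /nil0 t10; left; rewrite -tE1 t10.
  by rewrite bE => /nil0 t20; right; rewrite -tE2 t20.
split.
  by move=> /munit_phi u00; apply: u0; rewrite u00 enum_mset0.
move=> a b uab; have := umin (map cl (phi a)) (map cl (phi b)).
rewrite -map_cat uab (modelM phiP) perm_map ?perm_msetD // big_map phi_sum.
move=> /(_ erefl erefl)[] /(congr1 size) /eqP; rewrite size_map size_mset_eq0 => /eqP.
  by left; apply/munit_phi.
by right; apply/munit_phi.
Qed.

Lemma model_lift (s : seq G) : {in s, forall g, (cl @` Q) g} -> (\sum_(g <- s) g = 0)%R ->
  exists a, perm_eq (map cl (phi a)) s.
Proof.
move=> sQ sum_s.
have [t tQ tE] : exists2 t, (forall p, p \in t -> Q p) & map cl t = s.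
  elim: s sQ {sum_s} => [|g s IHs] sQ; first by exists [::].
  have [|t tQ <-] := IHs; first by move=> h hs; apply: sQ; rewrite inE hs orbT.
  have [p Qp <-] := sQ g (mem_head _ _).
  by exists (p :: t) => // q; rewrite inE => /predU1P[->|/tQ].
have /(model_im phiP)[a aE] : (forall p, p \in seq_mset t -> Q p) /\
    (\sum_(p <- seq_mset t) cl p = 0)%R.
  split=> [p|]; first by rewrite (perm_mem (perm_eq_seq_mset t)); exact: tQ.
  by rewrite (perm_big _ (perm_eq_seq_mset t)) -[RHS]sum_s -tE big_map.
by exists a; rewrite aE -tE perm_map // perm_eq_seq_mset.
Qed.

Lemma omega_bound_size u : omega_bound u (size (phi u)).
Proof.
move=> n v vat /phi_dvd; rewrite model_prod => /mset_cover[s [ss su us]].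
have s_uniq : uniq s by rewrite (subseq_uniq ss) // index_enum_uniq.
exists [set i in s]%SET; first by rewrite cardsE (card_uniqP s_uniq).
apply/phi_dvd; rewrite (eq_bigl (mem s)); last by move=> i; rewrite inE.
by rewrite -(big_uniq _ s_uniq) model_prod.
Qed.

End Model.

Lemma zero_sumP (G : zmodType) (G0 : set G) (U : block_monoid G0) :
  (forall g, g \in (submonoid_val U : {mset G}) -> G0 g) /\
  (\sum_(g <- (submonoid_val U : {mset G})) g = 0)%R.
Proof. exact/asboolP/(valP U). Qed.

(** The block monoid is a model as well, so [atom_phi] describes its atoms and those of [H] in the
    same terms. *)
Lemma block_model (G : zmodType) (G0 : set G) :
  zero_sum_model id G0 (fun U : block_monoid G0 => submonoid_val U).
Proof.
split=> //.
- move=> a b ab.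
  have [_ sum_a] := zero_sumP a; have [b0 sum_b] := zero_sumP b.
  have cP : (submonoid_val b `\` submonoid_val a)%mset \in zero_sum G0.
    apply/asboolP; split=> [g|].
      by move=> /(msubset_subset (msubsetDl _ _)); exact: b0.
    move: sum_b; rewrite -{1}(msetBDKC ab) (perm_big _ (perm_msetD _ _)) big_cat /=.
    by rewrite sum_a add0r.
  by exists (Submonoid cP); apply: val_inj; rewrite valM /= [RHS]msetBDKC.
- move=> z; split=> [[a <-]|zP]; first exact: zero_sumP.
  have zE : z \in zero_sum G0 by exact/asboolP.
  by exists (Submonoid zE).
Qed.

(** * The Davenport constant, existence of factorizations, and chains *)

Section Model.
Variables (M : ccMonoidType) (P : choiceType) (G : zmodType).
Variables (cl : P -> G) (phi : M -> {mset P}).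
Hypothesis phiP : zero_sum_model cl setT phi.
Implicit Types (a b u : M) (p q : P) (y z : {mset red_atom M}).

(** The class sequences of the atoms of [M] are exactly the atoms of the block monoid: choosing a
    prime in each class inverts the passage to classes. *)
Lemma davenportE (R : realType) :
  davenport (range cl) R = esup0 [set nat_ereal R (size (phi u)) | u in @atom M].
Proof.
congr esup0; apply/seteqP; split=> t [].
  move=> U /(atom_phi (block_model _)); rewrite map_id => Umin <- {t}.
  have [U0 sum_U] := zero_sumP U.
  have [u uU] := model_lift phiP U0 sum_U.
  exists u; last by rewrite -(perm_size uU) size_map.
  by apply/(atom_phi phiP); apply: perm_min_zero_sum Umin; rewrite perm_sym.
move=> u /(atom_phi phiP) umin <- {t}.
have UP : seq_mset (map cl (phi u)) \in zero_sum (range cl).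
  apply/asboolP; split=> [g|].
    by rewrite (perm_mem (perm_eq_seq_mset _)) => /mapP[p _ ->]; exists p.
  by rewrite (perm_big _ (perm_eq_seq_mset _)); case: umin.
exists (Submonoid UP : block_monoid _).
  apply/(atom_phi (block_model _)); rewrite map_id /=.
  by apply: perm_min_zero_sum umin; rewrite perm_sym perm_eq_seq_mset.
by rewrite /= (perm_size (perm_eq_seq_mset _)) size_map.
Qed.

Lemma model_surj (z : {mset P}) : (\sum_(p <- z) cl p = 0)%R -> exists a, phi a = z.
Proof. by move=> sz; apply/(model_im phiP). Qed.

(** Induction on the number of primes: a nonunit has at least one, so both factors of a proper
    factorization have fewer. *)
Lemma model_atomic a : exists z : {mset red_atom M}, factorizations a z.
Proof.
have [n] := ubnP (size (phi a)); elim: n a => // n IHn a an.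
have [ua|nua] := pselect (munit a).
  exists mset0; rewrite /factorizations /= enum_mset0 big_nil.
  by apply/(pi_phi phiP); rewrite (model1 phiP); apply/esym/(munit_phi phiP).
have [aat|naat] := pselect (atom a).
  have ua : `[< atom (\pi_(red M) a) >] by apply/asboolP/atom_pi.
  exists [mset (exist (fun v : red M => `[< atom v >] : Prop) _ ua : red_atom M)]%mset.
  by rewrite /factorizations /= enum_msetn big_seq1.
have [b [c [aE nb nc]]] : exists b c, [/\ a = b * c, ~ munit b & ~ munit c].
  apply: contrapT => nbc; apply: naat; split=> // b c abc.
  apply: contrapT => /not_orP[nb nc]; apply: nbc; by exists b, c.
have size_gt0 x : ~ munit x -> (0 < size (phi x))%N.
  by move=> nx; rewrite lt0n size_mset_eq0; apply/eqP => /(munit_phi phiP).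
have := size_gt0 b nb; have := size_gt0 c nc.
move: an; rewrite aE (modelM phiP) size_msetD => an c0 b0.
have [|zb zbE] := IHn b; first by lia.
have [|zc zcE] := IHn c; first by lia.
exists (zb `+` zc)%mset; apply: etrans (atoms_prodD zb zc) _; rewrite pi_redM.
by congr (_ * _).
Qed.

(** An inductive relation makes reversal, composition and multiplication by a common factor easy;
    [chained_path] converts it to the list form of [chain_bound]. *)
Inductive chained (N : nat) : {mset red_atom M} -> {mset red_atom M} -> Prop :=
| chained_step z z' : atoms_prod z = atoms_prod z' -> (fdist z z' <= N)%N -> chained N z z'
| chained_trans y x z : chained N x y -> chained N y z -> chained N x z.

Lemma chained_sym N z z' : chained N z z' -> chained N z' z.
Proof.
elim=> {z z'} [z z' zz' dzz'|y x z _ xy _ yz]; last exact: chained_trans xy.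
by apply: chained_step => //; rewrite /fdist maxnC msetIC.
Qed.

Lemma chainedD N y z z' : chained N z z' -> chained N (y `+` z)%mset (y `+` z')%mset.
Proof.
elim=> {z z'} [z z' zz' dzz'|x z z' _ zx _ xz']; last exact: chained_trans xz'.
by apply: chained_step; rewrite ?fdistD // !atoms_prodD zz'.
Qed.

Lemma chained_path N z z' : chained N z z' ->
  exists s, [/\ {in s, forall y, atoms_prod y = atoms_prod z}, last z s = z' &
                path (fun x y => fdist x y <= N)%N z s].
Proof.
elim=> {z z'} [z z' zz' dzz'|y x z _ [s [s1 s2 s3]] _ [t [t1 t2 t3]]].
  by exists [:: z']; split=> //= [y|]; rewrite ?inE ?dzz' // => /eqP->.
have yx : atoms_prod y = atoms_prod x.
  rewrite -s2; case: (lastP s) s1 => // s' w; rewrite last_rcons; apply.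
  by rewrite mem_rcons mem_head.
exists (s ++ t); split; last by rewrite cat_path s3 s2.
  by move=> w; rewrite mem_cat => /orP[/s1|/t1] // ->.
by rewrite last_cat s2.
Qed.

(** By [phi_repr] the chosen representative does not matter. *)
Definition fphi (z : {mset red_atom M}) : {mset P} := phi (repr (atoms_prod z)).

Lemma phi_repr (x : red M) a : x = \pi_(red M) a -> phi (repr x) = phi a.
Proof. by move=> xa; apply/(pi_phi phiP); rewrite reprK. Qed.

Lemma fphiD z z' : fphi (z `+` z')%mset = (fphi z `+` fphi z')%mset.
Proof.
by rewrite -(modelM phiP); apply: phi_repr; rewrite atoms_prodD pi_redM !reprK.
Qed.

Lemma fphi0 : fphi mset0 = mset0.
Proof. by rewrite /fphi (@phi_repr _ 1) ?(model1 phiP) // atoms_prod0. Qed.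

Lemma fphiE z : fphi z = \prod_(u <- z) fphi [mset u]%mset.
Proof.
have [n] := ubnP (size z); elim: n z => // n IHn z zn.
case: (mset_0Vmem z) => [->|[u uz]]; first by rewrite fphi0 enum_mset0 big_nil.
rewrite -(msetB1K uz) fphiD (perm_big _ (perm_msetD _ _)) big_cat /= enum_msetn big_seq1.
congr (_ * _); apply: IHn; move: zn; rewrite -{1}(msetB1K uz) size_msetD enum_msetn /=; lia.
Qed.

Lemma fphi_inj z z' : fphi z = fphi z' <-> atoms_prod z = atoms_prod z'.
Proof.
split=> [/(pi_phi phiP)|]; first by rewrite !reprK.
by rewrite /fphi => ->.
Qed.

Lemma fphi_gt0 z : (0 < size z)%N -> (0 < size (fphi z))%N.
Proof.
rewrite !lt0n !size_mset_eq0; apply: contra_neq => /(munit_phi phiP)/munit_pi.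
by rewrite reprK; exact: atoms_prod_munit.
Qed.

Lemma fphi_dvd y z : (fphi y `<=` fphi z)%mset ->
  exists w, atoms_prod (y `+` w)%mset = atoms_prod z.
Proof.
move=> /(model_dvd phiP)[c cE]; have [w wE] := model_atomic c.
exists w; rewrite atoms_prodD /atoms_prod wE -[LHS]/(atoms_prod y * _).
by rewrite -[atoms_prod y]reprK -pi_redM -cE reprK.
Qed.

(* An atom [u] of [z] divides a product of at most [N] atoms of [z'], hence
   [z'] is chained to a factorization containing [u], inside a proper divisor. *)
Lemma model_chained N : (forall u, atom u -> (size (phi u) <= N)%N) ->
  forall z z', atoms_prod z = atoms_prod z' -> chained N z z'.
Proof.
move=> phiN z z'.
have [n] := ubnP (size (fphi z)); elim: n z z' => // n IHn.
(* If neither factorization has more than [N] atoms, their distance is at most [N]; otherwise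
   symmetry of [chained] lets [z'] be the long one. *)
suff step z z' : (size (fphi z) < n.+1)%N -> atoms_prod z = atoms_prod z' ->
    (N < size z')%N -> chained N z z'.
  move=> z z' zn zz'; have [lez'|ltz'] := leqP (size z') N; last exact: step.
  have [lez|ltz] := leqP (size z) N.
    apply: chained_step => //; rewrite /fdist geq_max.
    have szB (A B : {mset red_atom M}) : (size (A `\` B)%mset <= size A)%N.
      by rewrite -!count_predT count_msubset // msubsetDl.
    by rewrite !(leq_trans (szB _ _)).
  by apply/chained_sym/step => //; rewrite -(proj2 (fphi_inj z z') zz').
move=> zn zz' ltz'.
have fzz' := proj2 (fphi_inj z z') zz'.
case: (mset_0Vmem z) => [z0|[u uz]].
  have := fphi_gt0 (z := z'); rewrite -fzz' z0 fphi0 size_mset0.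
  by move=> /(_ (leq_ltn_trans (leq0n _) ltz')).
have uN : (size (fphi [mset u]%mset) <= N)%N.
  apply: phiN; apply/atom_pi; rewrite reprK atoms_prod1; exact: red_atomP.
have zE := msetB1K uz; set z1 := (z `\ u)%mset in zE.
have : (fphi [mset u]%mset `<=` \prod_(v <- z') fphi [mset v]%mset)%mset.
  rewrite -fphiE -fzz' -zE fphiD; apply/mset_dvdP; by eexists.
move=> /mset_cover[s [/perm_to_subseq[t st] su us]].
have z'E := perm_mset_cat st.
set y := seq_mset s in z'E; set y1 := seq_mset t in z'E.
have sy : size y = size s by rewrite (perm_size (perm_eq_seq_mset s)).
have [w wE] : exists w, atoms_prod ([mset u] `+` w)%mset = atoms_prod y.
  by apply: fphi_dvd; rewrite [fphi y]fphiE (perm_big _ (perm_eq_seq_mset s)).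
(* The number of primes drops in both uses of the induction hypothesis: [z1] lacks the atom [u], and
   [y] lacks [y1], which is nonempty because [z'] has more than [N] atoms and [s] at most [N]. *)
have fu0 : (0 < size (fphi [mset u]%mset))%N by rewrite fphi_gt0 // enum_msetn.
have fy1 : (0 < size (fphi y1))%N.
  by rewrite fphi_gt0 //; move: ltz'; rewrite z'E size_msetD; lia.
have wy : chained N ([mset u] `+` w)%mset y.
  apply: IHn => //; rewrite (proj2 (fphi_inj _ _) wE).
  by move: zn; rewrite fzz' z'E fphiD size_msetD; lia.
have z1w : chained N z1 (w `+` y1)%mset.
  apply: IHn.
    by move: zn; rewrite -zE fphiD size_msetD; lia.
  move: zz'; rewrite -zE z'E !atoms_prodD -wE atoms_prodD -mulgA.
  by rewrite ![atoms_prod [mset u]%mset * _]ccmulC => /ccmulI.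
(* The chain leads from [u] and [z1] through [u], [w] and [y1] to [y] and [y1], that is, to [z']. *)
rewrite -zE; apply: chained_trans (chainedD [mset u]%mset z1w) _.
by rewrite z'E msetDA msetDC [X in chained _ _ X]msetDC; exact: chainedD.
Qed.

Lemma model_chain_bound N : (forall u, atom u -> (size (phi u) <= N)%N) -> chain_bound M N.
Proof.
move=> phiN a z z' za z'a.
have [|s [s1 s2 s3]] := chained_path (model_chained phiN (z := z) (z' := z') _).
  by rewrite /atoms_prod za.
by exists s; split=> // y /s1; rewrite /atoms_prod /factorizations /= => ->.
Qed.

End Model.

(** * Lengths of products *)

Section LengthsMul.
Variable M : ccMonoidType.
Implicit Types a b u : M.

Lemma lengthsM a b m n : lengths a m -> lengths b n -> lengths (a * b) (m + n)%N.
Proof.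
move=> [y ya <-] [z zb <-]; exists (y `+` z)%mset; last by rewrite size_msetD.
by apply: etrans (atoms_prodD y z) _; rewrite pi_redM; congr (_ * _).
Qed.

Lemma lengths1 : lengths (1 : M) 0.
Proof. by apply/lengthsP; exists [::]; split=> //; rewrite big_nil. Qed.

Lemma lengthsX a n k : lengths a n -> lengths (a ^+ k) (k * n)%N.
Proof.
move=> an; elim: k => [|k IHk]; first exact: lengths1.
by rewrite expgS mulSn; exact: lengthsM.
Qed.

Lemma lengths_atom u : atom u -> lengths u 1%N.
Proof.
move=> uat; apply/lengthsP; exists [:: u]; rewrite big_seq1; split=> // v.
by rewrite inE => /eqP->.
Qed.

Lemma lengths_seq (s : seq M) : {in s, forall u, atom u} ->
  lengths (\prod_(u <- s) u) (size s).
Proof. by move=> sat; apply/lengthsP; exists s. Qed.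

Lemma lengths_nonunit2 a b n : ~ munit a -> ~ munit b -> lengths (a * b) n -> (2 <= n)%N.
Proof.
move=> na nb /lengthsP[[|u [|v s]] [sat <- //]].
  rewrite big_nil => ab; case: na; apply/(munitMl (b := b))/munit_pi.
  by rewrite -ab; apply/munit_pi; exact: munit1.
rewrite big_seq1 => uE; have /atom_pi : atom u by apply: sat; rewrite mem_head.
by rewrite uE => /atom_pi[_ /(_ _ _ erefl)] [].
Qed.

End LengthsMul.

(** * Opposite elements in minimal zero-sum sequences *)

Section MinZeroSumOpp.
Variable G : zmodType.
Implicit Types s : seq G.

(** The pair is itself a zero-sum subsequence; as [g] and [- g] differ, the two memberships suffice
    to bound the multiplicities. *)
Lemma min_zero_sum_opp_in s g : min_zero_sum s -> g \in s -> (- g)%R \in s ->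
  g != (- g)%R -> perm_eq s [:: g; (- g)%R].
Proof.
move=> smin gs ngs gg; apply: min_zero_sum_sub => //.
  apply: leq_uniq_count; first by rewrite /= inE gg.
  by move=> h; rewrite !inE => /orP[] /eqP->.
by rewrite big_cons big_seq1 subrr.
Qed.

Lemma min_zero_sum0 s : min_zero_sum s -> 0%R \in s -> s = [:: 0%R].
Proof.
move=> smin s0; apply/perm_small_eq => //; apply: min_zero_sum_sub => //; last by rewrite big_seq1.
by apply: leq_uniq_count => // h; rewrite inE => /eqP->.
Qed.

Lemma min_zero_sum_pair (g : G) : g <> 0%R -> min_zero_sum [:: g; (- g)%R].
Proof.
move=> g0; split=> //; first by rewrite big_cons big_seq1 subrr.
move=> [|x [|y s1]] s2; [by left| |].
  move=> gx; rewrite big_seq1 => x0.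
  have : x \in [:: g; (- g)%R] by rewrite (perm_mem gx) mem_head.
  by rewrite x0 !inE ![0%R == _]eq_sym oppr_eq0 orbb => /eqP.
by move=> /perm_size /=; rewrite size_cat; case: s2 => [|? ?]; [right|rewrite /=; lia].
Qed.

Lemma min_zero_sum_opp s : min_zero_sum s -> min_zero_sum (map -%R%R s).
Proof.
move=> [s0 sum_s smin]; split.
- by move=> /(congr1 size); rewrite size_map => /size0nil.
- by rewrite big_map sumrN sum_s oppr0.
move=> s1 s2 /(perm_map -%R%R); rewrite mapK; last exact: opprK.
rewrite map_cat => s12 sum1; have [] := smin _ _ s12.
- by rewrite big_map sumrN sum1 oppr0.
- by move=> /(congr1 size); rewrite size_map => /size0nil; left.
- by move=> /(congr1 size); rewrite size_map => /size0nil; right.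
Qed.

End MinZeroSumOpp.

(** * Bounds on lengths, and pairing primes with opposite classes *)

Section Model.
Variables (M : ccMonoidType) (P : choiceType) (G : zmodType).
Variables (cl : P -> G) (phi : M -> {mset P}).
Hypothesis phiP : zero_sum_model cl setT phi.
Implicit Types (a b u : M) (p q : P) (y z : {mset red_atom M}).

Definition zero_class : pred P := fun p => cl p == 0%R.

(** An atom containing a prime of class 0 is that prime alone and weighs 2. Any other atom has at
    least two primes, and its weight is its size. *)
Lemma atom_weight u N : atom u -> (2 <= N)%N -> (size (phi u) <= N)%N ->
  (2 <= size (phi u) + count zero_class (phi u) <= N)%N.
Proof.
move=> /(atom_phi phiP) umin N2 uN.
have cE : count zero_class (phi u) = count_mem 0%R (map cl (phi u)).
  by rewrite count_map.
have sE : size (phi u) = size (map cl (phi u)) by rewrite size_map.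
rewrite cE sE in uN *; move: (map cl (phi u)) umin uN => s smin sN {cE sE}.
have [s0|s0] := boolP (0%R \in s).
  by rewrite (min_zero_sum0 smin s0) /= eqxx; lia.
rewrite (count_memPn s0) addn0 sN andbT.
case: smin s0 {sN} => + + _; case: s => [|g [|h s]] // _.
by rewrite big_seq1 => ->; rewrite mem_head.
Qed.

(* Both sides are compared with the number of primes of [phi a], those of
   class [0] being counted twice. *)
Lemma lengths_le a m n N : (forall u, atom u -> (size (phi u) <= N)%N) -> (2 <= N)%N ->
  lengths a m -> lengths a n -> (2 * n <= m * N)%N.
Proof.
move=> phiN N2 /lengthsP[s [sat <- sa]] /lengthsP[t [tat <- ta]].
pose W u := (size (phi u) + count zero_class (phi u))%N.
have WE (r : seq M) : \pi_(red M) (\prod_(u <- r) u) = \pi_(red M) a ->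
    W a = (\sum_(u <- r) W u)%N.
  move=> /(pi_phi phiP) ra; rewrite /W -ra (model_prod phiP) big_split /=.
  rewrite -count_prod_mset; congr (_ + _)%N; rewrite -count_predT count_prod_mset.
  by apply: eq_bigr => u _; rewrite count_predT.
apply: (@leq_trans (W a)).
  rewrite (WE t ta) mulnC -sum1_size big_distrl /= !big_seq; apply: leq_sum => u ut.
  by have /andP[] := atom_weight (tat u ut) N2 (phiN u (tat u ut)).
rewrite (WE s sa) -sum1_size big_distrl /= !big_seq; apply: leq_sum => u us.
by have /andP[_] := atom_weight (sat u us) N2 (phiN u (sat u us)); rewrite mul1n.
Qed.

Hypothesis cl_opp : forall p, cl p <> 0%R -> exists q, cl q = (- cl p)%R.
Hypothesis no2torsion : forall g : G, (g + g = 0)%R -> g = 0%R.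

Lemma neq_opp (g : G) : g <> 0%R -> g != (- g)%R.
Proof. by move=> g0; apply/eqP => gg; apply/g0/no2torsion; rewrite {1}gg addNr. Qed.

Lemma model_atom (s : seq P) : min_zero_sum (map cl s) ->
  exists2 u, atom u & phi u = seq_mset s.
Proof.
move=> smin; have [u uE] : exists u, phi u = seq_mset s.
  apply: (model_surj phiP); rewrite (perm_big _ (perm_eq_seq_mset s)).
  by case: smin => _ + _; rewrite big_map.
exists u => //; apply/(atom_phi phiP); rewrite uE.
by apply: perm_min_zero_sum smin; rewrite perm_map // perm_sym perm_eq_seq_mset.
Qed.

(** A prime of class [- cl p] dividing [u] would form with [p] a zero-sum pair exhausting [u], which
    has more than two primes. Outside [phi u] the value of [f] is arbitrary. *)
Lemma opp_choice u : atom u -> (2 < size (phi u))%N ->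
  exists f : P -> P, forall p, p \in phi u ->
    [/\ cl p <> 0%R, cl (f p) = (- cl p)%R & f p \notin phi u].
Proof.
move=> /(atom_phi phiP) umin u2.
have H p : exists q, p \in phi u -> [/\ cl p <> 0%R, cl q = (- cl p)%R & q \notin phi u].
  have [pu|] := boolP (p \in phi u); last by exists p.
  have p0 : cl p <> 0%R.
    move=> p0; have := min_zero_sum0 umin; rewrite -p0 map_f // => /(_ erefl).
    by move=> /(congr1 size); rewrite size_map; move: u2 => /[swap] ->.
  have [q qE] := cl_opp p0; exists q => _; split=> //; apply/negP => qu.
  have /perm_size := min_zero_sum_opp_in umin (map_f cl pu)
    (eq_ind _ (fun g => g \in _) (map_f cl qu) _ qE) (neq_opp p0).
  by rewrite size_map; move: u2 => /[swap] ->.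
by have [f fP] := choice H; exists f.
Qed.

Lemma prod_pair (s : seq P) (f : P -> P) :
  \prod_(p <- s) seq_mset [:: p; f p] = (seq_mset s `+` seq_mset (map f s))%mset.
Proof.
elim: s => [|p s IHs] /=.
  by rewrite big_nil; apply/msetP => x; rewrite msetE2 !mset_seqE mset0E.
rewrite big_cons IHs; apply/msetP => x; rewrite !msetE2 !mset_seqE /=; lia.
Qed.

Lemma pair_choice u : atom u -> (2 < size (phi u))%N ->
  exists (f : P -> P) (V : P -> M), forall p, p \in phi u ->
    [/\ cl (f p) = (- cl p)%R, f p \notin phi u, atom (V p) &
        phi (V p) = seq_mset [:: p; f p]].
Proof.
move=> uat u2; have [f fP] := opp_choice uat u2.
have H p : exists v, p \in phi u -> atom v /\ phi v = seq_mset [:: p; f p].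
  have [/fP[p0 fpE fpu]|_] := boolP (p \in phi u); last by exists 1.
  have [|v vat vE] := model_atom (s := [:: p; f p]); last by exists v.
  by rewrite /= fpE; exact: min_zero_sum_pair.
have [V VP] := choice H; exists f, V => p pu.
by have [] := fP p pu; have [] := VP p pu; split.
Qed.

(** [u] divides the product of the pairs [V p], taken over its primes. Each pair contains only one
    prime of [u], since [f p] does not divide [u]; hence a subproduct divisible by [u] needs
    [size (phi u)] of them. *)
Lemma omega_bound_ge u N : atom u -> (2 < size (phi u))%N -> omega_bound u N ->
  (size (phi u) <= N)%N.
Proof.
move=> uat u2 uN; have [f [V VP]] := pair_choice uat u2.
(* The factors are indexed by positions, so that a repeated prime yields several factors. *)
have uE i : tnth (in_tuple (phi u)) i \in phi u by exact: mem_tnth.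
have [|| O ON] := uN _ (fun i => V (tnth (in_tuple (phi u)) i)).
- by move=> i; have [] := VP _ (uE i).
- apply/(phi_dvd phiP); rewrite (model_prod phiP).
  rewrite -(big_tnth _ _ _ xpredT (fun p => phi (V p))) big_seq.
  rewrite (eq_bigr (fun p => seq_mset [:: p; f p])); last by move=> p /VP[].
  rewrite -big_seq prod_pair seq_mset_id; apply/mset_dvdP; by eexists.
move=> /(phi_dvd phiP) /(count_msubset (mem (phi u))).
rewrite -big_enum (model_prod phiP) count_prod_mset /=.
rewrite (_ : count _ (phi u) = size (phi u)); last first.
  by apply/eqP; rewrite -all_count; apply/allP.
move=> /leq_trans; apply; apply: leq_trans ON.
rewrite cardE -[leqRHS]sum1_size; apply: leq_sum => i _.
have [_ fpu _ ->] := VP _ (uE i).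
by rewrite (seq.permP (perm_eq_seq_mset _)) /= (negbTE fpu) uE.
Qed.

(** [u'] collects the partners [f p] of the primes of [u]; its class sequence is the negative of
    that of [u]. The product [u * u'] regroups into the pairs [V p]. *)
Lemma atom_opp u : atom u -> (2 < size (phi u))%N ->
  exists u' (s : seq M),
    [/\ atom u' /\ {in phi u', forall q, exists2 p, p \in phi u & cl q = (- cl p)%R},
        {in s, forall v, atom v}, size s = size (phi u) &
        phi (\prod_(v <- s) v) = phi (u * u')].
Proof.
move=> uat u2; have [f [V VP]] := pair_choice uat u2.
have [|u' u'at u'E] := model_atom (s := map f (phi u)).
  rewrite -map_comp; have /min_zero_sum_opp := proj1 (atom_phi phiP u) uat.
  rewrite -map_comp; congr min_zero_sum; apply/eq_in_map => p /VP[fpE _ _ _].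
  by rewrite /= fpE.
exists u', (map V (phi u)); split.
- split=> // q; rewrite u'E (perm_mem (perm_eq_seq_mset _)) => /mapP[p pu ->].
  by exists p => //; have [] := VP p pu.
- by move=> _ /mapP[p /VP[_ _ + _] ->].
- by rewrite size_map.
rewrite (model_prod phiP) big_map big_seq.
rewrite (eq_bigr (fun p => seq_mset [:: p; f p])); last by move=> p /VP[].
by rewrite -big_seq prod_pair seq_mset_id (modelM phiP) u'E.
Qed.

Lemma lengths_atom_opp u : atom u -> (2 < size (phi u))%N ->
  exists u', [/\ atom u',
    {in phi u', forall q, exists2 p, p \in phi u & cl q = (- cl p)%R},
    lengths (u * u') 2 & lengths (u * u') (size (phi u))].
Proof.
move=> uat u2; have [u' [s [[u'at u'cl] sat ss sE]]] := atom_opp uat u2.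
exists u'; split=> //.
  exact: (lengthsM (lengths_atom uat) (lengths_atom u'at)).
rewrite -ss -(lengths_eq (a := \prod_(v <- s) v)); first exact: lengths_seq.
exact/(pi_phi phiP).
Qed.

End Model.

(** * The invariants omega, rho and the catenary degree *)

Section Esup0.
Variable R : realType.
Implicit Types (A : set nat) (x : \bar R).

Lemma esup0_ge0 (B : set (\bar R)) : (0 <= esup0 B)%E.
Proof. by apply: ereal_sup_ubound; left. Qed.

Lemma esup0_ubound (B : set (\bar R)) x : B x -> (x <= esup0 B)%E.
Proof. by move=> Bx; apply: ereal_sup_ubound; right. Qed.

Lemma esup0_le (B : set (\bar R)) x : (0 <= x)%E -> (forall y, B y -> (y <= x)%E) ->
  (esup0 B <= x)%E.
Proof. by move=> x0 Bx; apply: ge_ereal_sup => y [->|/Bx]. Qed.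

Lemma nat_ereal_le m n : (nat_ereal R m <= nat_ereal R n)%E = (m <= n)%N.
Proof. by rewrite lee_fin ler_nat. Qed.

Lemma nat_ereal_ge0 n : (0 <= nat_ereal R n)%E.
Proof. by rewrite lee_fin. Qed.

Lemma ereal_nat_unbounded x (c : R) : (0 < c)%R ->
  (forall n, exists2 m, (n <= m)%N & (nat_ereal R m * c%:E <= x)%E) -> x = +oo%E.
Proof.
move=> c0 H; apply/eqyP => r r0.
have rc0 : (0 <= r / c)%R by rewrite divr_ge0 ?ltW.
have [m nm mx] := H (Num.bound (r / c)); apply: le_trans mx.
rewrite /nat_ereal -EFinM lee_fin -ler_pdivrMr //.
by apply: le_trans (ltW (archi_boundP rc0)) _; rewrite ler_nat.
Qed.

Lemma esup0_natP A : A !=set0 ->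
  let s := esup0 [set nat_ereal R n | n in A] in
  (exists N, [/\ A N, forall n, A n -> (n <= N)%N & s = nat_ereal R N]) \/
  (s = +oo%E /\ forall n, exists2 m, A m & (n <= m)%N).
Proof.
move=> [n0 An0] s; have [[N AN]|unb] := pselect (exists N, forall n, A n -> (n <= N)%N).
  left; have exA : exists n, `[< A n >] by exists n0; apply/asboolP.
  have leN n : `[< A n >] -> (n <= N)%N by move=> /asboolP/AN.
  case: (ex_maxnP exA leN) => m /asboolP Am mmax; exists m; split=> //.
    by move=> n An; apply: mmax; apply/asboolP.
  apply/eqP; rewrite eq_le; apply/andP; split.
    apply: esup0_le; first exact: nat_ereal_ge0.
    by move=> _ [n An <-]; rewrite nat_ereal_le; apply: mmax; apply/asboolP.
  by apply: esup0_ubound; exists m.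
have large n : exists2 m, A m & (n <= m)%N.
  apply: contrapT => nm; apply: unb; exists n => k Ak.
  by rewrite leqNgt; apply/negP => nk; apply: nm; exists k => //; exact: ltnW.
right; split=> //; apply: (@ereal_nat_unbounded _ 1%R) => // n.
have [m Am nm] := large n; exists m => //.
by rewrite mule1; apply: esup0_ubound; exists m.
Qed.

(** An attained supremum is one of the values tested; an infinite one comes from an unbounded [A],
    which forces [x = +oo]. *)
Lemma esup0_nat_scale A (c : R) x : A !=set0 -> (0 < c)%R ->
  (forall n, A n -> (nat_ereal R n * c%:E <= x)%E) ->
  (esup0 [set nat_ereal R n | n in A] * c%:E <= x)%E.
Proof.
move=> A0 c0 Ax; have [[N [AN _ ->]]|[-> large]] := esup0_natP A0; first exact: Ax.
rewrite (@ereal_nat_unbounded x c) ?leey // => n.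
by have [m /Ax mx nm] := large n; exists m.
Qed.

End Esup0.

(** * The invariants in terms of the Davenport constant *)

Section Invariants.
Variables (M : ccMonoidType) (P : choiceType) (G : zmodType).
Variables (cl : P -> G) (phi : M -> {mset P}).
Hypothesis phiP : zero_sum_model cl setT phi.
Hypothesis cl_opp : forall p, cl p <> 0%R -> exists q, cl q = (- cl p)%R.
Hypothesis no2torsion : forall g : G, (g + g = 0)%R -> g = 0%R.
Variables (R : realType) (u0 : M).
Hypotheses (u0_atom : atom u0) (u0_size : (2 < size (phi u0))%N).

Let sizes : set nat := [set size (phi u) | u in @atom M].
Let D : \bar R := davenport (range cl) R.

Let DE : D = esup0 [set nat_ereal R n | n in sizes].
Proof. by rewrite /D (davenportE phiP) -image_comp. Qed.

Let sizes0 : sizes !=set0. Proof. by exists (size (phi u0)), u0. Qed.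

(** Atoms with at most two primes are dominated by [u0], so lower bounds need testing only where the
    pairing construction applies. *)
Let D_scale (c : R) x : (0 < c)%R ->
  (forall u, atom u -> (2 < size (phi u))%N -> (nat_ereal R (size (phi u)) * c%:E <= x)%E) ->
  (D * c%:E <= x)%E.
Proof.
move=> c0 H; rewrite DE; apply: esup0_nat_scale => // _ [u uat <-].
have [u2|u2] := ltnP 2 (size (phi u)); first exact: H.
apply: le_trans (H u0 u0_atom u0_size); rewrite lee_pmul2r //.
by rewrite nat_ereal_le; lia.
Qed.

Let D_cases : (exists N, [/\ (2 <= N)%N, forall u, atom u -> (size (phi u) <= N)%N &
  D = nat_ereal R N]) \/ D = +oo%E.
Proof.
have [[N [_ sN]]|[]] := esup0_natP R sizes0; rewrite -DE => DN; last by right.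
left; exists N; split=> //; last by move=> u uat; apply: sN; exists u.
by apply: leq_trans (ltnW u0_size) _; apply: sN; exists u0.
Qed.

Lemma omega_davenport : omega M R = D.
Proof.
apply/eqP; rewrite eq_le; apply/andP; split.
  apply: esup0_le => [|_ [u uat <-]]; first exact: esup0_ge0.
  apply: (@le_trans _ _ (nat_ereal R (size (phi u)))).
    apply: ereal_inf_lbound; exists (size (phi u)) => //.
    exact: omega_bound_size phiP u.
  by rewrite DE; apply: esup0_ubound; exists (size (phi u)) => //; exists u.
rewrite -[D]mule1; apply: D_scale => // u uat u2; rewrite mule1.
apply: le_trans (esup0_ubound (x := omega_at R u) _); last by exists u.
apply: le_ereal_inf_tmp => _ [N uN <-]; rewrite nat_ereal_le.
exact: (omega_bound_ge phiP cl_opp no2torsion uat u2 uN).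
Qed.

Lemma catenary_le_davenport : (catenary_degree M R <= D)%E.
Proof.
have [[N [_ sN ->]]|->] := D_cases; last exact: leey.
apply: ereal_inf_lbound; exists N => //; exact: (model_chain_bound phiP sN).
Qed.

Lemma elasticity_davenport : elasticity M R = (D * (2^-1)%:E)%E.
Proof.
have half0 : (0 < 2^-1 :> R)%R by rewrite invr_gt0.
apply/eqP; rewrite eq_le; apply/andP; split.
  apply: esup0_le => [|_ [A [m [[a _ <-] L0 [Lm mmin] ->]]]].
    by rewrite mule_ge0 ?esup0_ge0 // lee_fin ltW.
  have [[N [N2 sN ->]]|->] := D_cases; last first.
    by rewrite gt0_mulye ?leey // lte_fin.
  (* A length 0 would force all lengths to be 0 by [lengths_le], against [L0]; so the division by
     [m] is genuine. *)
  have m0 : (0 < m)%N.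
    rewrite lt0n; apply/eqP => m0; apply: L0; apply/seteqP; split=> [n Ln|_ ->].
      by have := lengths_le phiP sN N2 Lm Ln; rewrite m0 mul0n /=; lia.
    by rewrite -m0.
  rewrite lee_pdivrMr ?ltr0n //; apply: esup0_le => [|_ [n Ln <-]].
    by rewrite /nat_ereal -!EFinM lee_fin !mulr_ge0 // ltW.
  rewrite /nat_ereal -!EFinM lee_fin mulrAC ler_pdivlMr // -!natrM ler_nat.
  by have := lengths_le phiP sN N2 Lm Ln; lia.
(* The element [u * u'] has minimal length 2 and also the length [size (phi u)]. *)
apply: D_scale => // u uat u2.
have [u' [u'at _ L2 Lu]] := lengths_atom_opp phiP cl_opp no2torsion uat u2.
have le_el : (esup0 [set nat_ereal R l | l in lengths (u * u')%g] * (2^-1)%:E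
              <= elasticity M R)%E.
  apply: esup0_ubound; exists (lengths (u * u')), 2; split=> //.
  - by exists (u * u').
  - by move=> L0; move: L2; rewrite L0.
  - split=> // n; apply: lengths_nonunit2; by [case: uat | case: u'at].
apply: le_trans le_el; rewrite lee_pmul2r //.
by apply: esup0_ubound; exists (size (phi u)).
Qed.

Lemma rho_davenport k : (0 < k)%N -> rho_k M R (2 * k) = (nat_ereal R k * D)%E.
Proof.
move=> k0; have k0R : (0 < k%:R :> R)%R by rewrite ltr0n.
apply/eqP; rewrite eq_le; apply/andP; split.
  apply: esup0_le => [|_ [n [A [[a _ <-] L2k] Ln] <-]].
    by rewrite mule_ge0 ?esup0_ge0 ?nat_ereal_ge0.
  have [[N [N2 sN ->]]|->] := D_cases; last by rewrite gt0_muley ?leey.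
  rewrite /nat_ereal -EFinM -natrM lee_fin ler_nat.
  by have := lengths_le phiP sN N2 L2k Ln; lia.
rewrite muleC; apply: D_scale => // u uat u2.
have [u' [u'at _ L2 Lu]] := lengths_atom_opp phiP cl_opp no2torsion uat u2.
(* The [k]-th power of [u * u'] has the lengths [2 * k] and [k * size (phi u)]. *)
apply: esup0_ubound; exists (k * size (phi u))%N.
  exists (lengths ((u * u') ^+ k)); last exact: lengthsX.
  by split; [exists ((u * u') ^+ k) | rewrite mulnC; exact: lengthsX].
by rewrite /nat_ereal natrM muleC EFinM.
Qed.

End Invariants.

(** * Circuits *)

Section Circuit.
Variables (G : zmodType) (n : nat) (v : 'I_n.+1 -> G) (c : 'I_n.+1 -> nat).

Definition circuit :=
  [/\ c ord0 = 1%N, forall j, (0 < c j)%N &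
      forall a : 'I_n.+1 -> int,
        (\sum_j v j *~ a j = 0)%R <-> forall j, a j = (a ord0 * (c j)%:Z)%R].

Definition circuit_length := (\sum_j c j)%N.

Definition circuit_seq : seq G := flatten [seq nseq (c j) (v j) | j <- enum 'I_n.+1].

Definition circuit_supp : set G := [set g | exists j, g = v j \/ g = (- v j)%R].

(** The net multiplicity of [v j]; for a zero-sum sequence over [circuit_supp] these integers form a
    relation among the [v j]. *)
Definition excess (j : 'I_n.+1) (s : seq G) : int :=
  ((count_mem (v j) s)%:Z - (count_mem (- v j) s)%:Z)%R.

Hypotheses (v_circuit : circuit) (long : (2 < circuit_length)%N).
Implicit Types (i j k : 'I_n.+1) (s : seq G).

(** Excludes coincidences: [v i = v j] would give a nonzero relation with coefficient sum 0, and
    [v i = - v j] one with sum 2, too small for a circuit of length above 2. *)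
Lemma circuit_rel_sum (a : 'I_n.+1 -> int) : (\sum_j v j *~ a j = 0)%R ->
  (\sum_j a j = a ord0 * circuit_length%:Z)%R.
Proof.
case: v_circuit => _ _ H /H aE; rewrite /circuit_length (big_morph Posz PoszD (erefl _)).
by rewrite mulr_sumr; apply: eq_bigr.
Qed.

Lemma sum_delta j : (\sum_k v k *~ (k == j)%:Z = v j)%R.
Proof.
by rewrite (bigD1 j) //= eqxx mulr1z big1 ?addr0 // => k /negbTE->; rewrite mulr0z.
Qed.

Lemma int_sum_delta j : (\sum_k (k == j)%:Z = 1)%R.
Proof. by rewrite (bigD1 j) //= eqxx big1 ?addr0 // => k /negbTE->. Qed.

Lemma circuit_inj : injective v.
Proof.
move=> i j vij; apply/eqP; apply: contraT => /negbTE ij.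
pose a k := ((k == i)%:Z - (k == j)%:Z)%R.
have rel : (\sum_k v k *~ a k = 0)%R.
  under eq_bigr do rewrite mulrzBr.
  by rewrite sumrB !sum_delta vij subrr.
have := circuit_rel_sum rel; rewrite sumrB !int_sum_delta subrr => a0.
case: v_circuit => _ _ H; have /H/(_ i) := rel.
have -> : a ord0 = 0%R by move: a0 long => /esym/eqP; rewrite mulf_eq0 => /orP[/eqP//|]; lia.
by rewrite /a eqxx ij mul0r.
Qed.

Lemma circuit_opp i j : v i != (- v j)%R.
Proof.
apply/eqP => vij; pose a k := ((k == i)%:Z + (k == j)%:Z)%R.
have rel : (\sum_k v k *~ a k = 0)%R.
  under eq_bigr do rewrite mulrzDr.
  by rewrite big_split /= !sum_delta vij addNr.
have := circuit_rel_sum rel; rewrite big_split /= !int_sum_delta.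
have : (0 <= a ord0)%R by rewrite /a; lia.
move: (a ord0) circuit_length long => x L L2 x0 xL.
have [x00|x1] : x = 0%R \/ (1 <= x)%R by lia.
  by move: xL; rewrite x00 mul0r.
have : (L%:Z <= x * L%:Z)%R by rewrite ler_peMl.
by rewrite -xL; lia.
Qed.

Lemma circuit_neq0 j : v j <> 0%R.
Proof. by move=> v0; have := circuit_opp j j; rewrite v0 oppr0 eqxx. Qed.

Lemma circuit_supp_sum s : {in s, forall g, circuit_supp g} ->
  (\sum_(g <- s) g = \sum_j v j *~ excess j s)%R /\
  size s = (\sum_j (count_mem (v j) s + count_mem (- v j)%R s))%N.
Proof.
elim: s => [|g s IHs] sv.
  rewrite /excess /= big_nil; split; first by rewrite big1 // => j _; rewrite subrr mulr0z.
  by rewrite big1.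
have [|sum_s size_s] := IHs; first by move=> h hs; apply: sv; rewrite inE hs orbT.
have [k gE] : circuit_supp g by apply: sv; rewrite mem_head.
have vv j : (v k == v j) = (j == k) by rewrite (inj_eq circuit_inj) eq_sym.
have nv j : (v k == - v j)%R = false by apply/negbTE/circuit_opp.
have vn j : (- v k == v j)%R = false by rewrite eq_sym; apply/negbTE/circuit_opp.
have nn j : (- v k == - v j)%R = (j == k) by rewrite eqr_opp vv.
have nat_delta : (\sum_j (j == k) = 1)%N.
  by rewrite (bigD1 k) //= eqxx big1 // => j /negbTE->.
rewrite big_cons sum_s /= size_s; case: gE => ->; split.
- rewrite -{1}(sum_delta k) -big_split /=; apply: eq_bigr => j _.
  by rewrite -mulrzDr /excess /= vv nv add0n PoszD addrA.
- rewrite -add1n -nat_delta -big_split /=; apply: eq_bigr => j _.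
  by rewrite vv nv add0n addnA.
- rewrite -{1}(sum_delta k) -sumrN -big_split /=; apply: eq_bigr => j _.
  by rewrite -mulrNz -mulrzDr /excess /= nn vn add0n PoszD opprD addrCA.
- rewrite -add1n -nat_delta -big_split /=; apply: eq_bigr => j _.
  by rewrite nn vn add0n addnCA.
Qed.

Lemma circuit_excess s j : {in s, forall g, circuit_supp g} -> (\sum_(g <- s) g = 0)%R ->
  excess j s = (excess ord0 s * (c j)%:Z)%R.
Proof.
move=> sv s0; have [sE _] := circuit_supp_sum sv.
by case: v_circuit => _ _ H; have /H := etrans (esym sE) s0.
Qed.

Lemma excess_cat j s1 s2 : excess j (s1 ++ s2) = (excess j s1 + excess j s2)%R.
Proof. by rewrite /excess !count_cat !PoszD opprD addrACA. Qed.

Lemma perm_excess j s1 s2 : perm_eq s1 s2 -> excess j s1 = excess j s2.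
Proof. by move=> /seq.permP s12; rewrite /excess !s12. Qed.

Lemma excess_opp j s : excess j (map -%R%R s) = (- excess j s)%R.
Proof.
rewrite /excess !count_map opprB.
by congr (Posz _ - Posz _)%R; apply: eq_count => g /=; rewrite ?eqr_opp // eqr_oppLR.
Qed.

Lemma mem_circuit_seq g : g \in circuit_seq -> exists j, g = v j.
Proof. by move=> /flatten_mapP[j _]; rewrite mem_nseq => /andP[_ /eqP->]; exists j. Qed.

Lemma circuit_seq_supp : {in circuit_seq, forall g, circuit_supp g}.
Proof. by move=> g /mem_circuit_seq[j ->]; exists j; left. Qed.

Lemma size_circuit_seq : size circuit_seq = circuit_length.
Proof.
rewrite /circuit_seq size_flatten /shape -map_comp sumnE big_map big_enum /=.
by apply: eq_bigr => j _; rewrite size_nseq.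
Qed.

Lemma count_circuit_seq j : count_mem (v j) circuit_seq = c j.
Proof.
rewrite /circuit_seq count_flatten -map_comp sumnE big_map big_enum /=.
rewrite (bigD1 j) //= count_nseq /= eqxx mul1n big1 ?addn0 // => k kj.
by rewrite count_nseq /= (inj_eq circuit_inj) (negbTE kj).
Qed.

Lemma count_circuit_seqN j : count_mem (- v j)%R circuit_seq = 0%N.
Proof.
apply/count_memPn/negP => /mem_circuit_seq[k vjk].
by have := circuit_opp k j; rewrite vjk eqxx.
Qed.

Lemma sum_circuit_seq : (\sum_(g <- circuit_seq) g = 0)%R.
Proof.
have [-> _] := circuit_supp_sum circuit_seq_supp.
case: v_circuit => c0 _ H; apply/H => j.
by rewrite /excess !count_circuit_seq !count_circuit_seqN !subr0 c0 mul1r.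
Qed.

Lemma circuit_seq_neq0 : circuit_seq <> [::].
Proof. by move=> /(congr1 size); rewrite size_circuit_seq /=; move: long => /[swap] ->. Qed.

Lemma circuit_pos_size s : {in s, forall g, circuit_supp g} -> (\sum_(g <- s) g = 0)%R ->
  (forall j, count_mem (- v j)%R s = 0%N) ->
  size s = (count_mem (v ord0) s * circuit_length)%N.
Proof.
move=> sv s0 sneg; have [_ ->] := circuit_supp_sum sv.
rewrite big_distrr /=; apply: eq_bigr => j _; rewrite sneg addn0.
by have := circuit_excess j sv s0; rewrite /excess !sneg !subr0 -PoszM => -[].
Qed.

(** Since [c ord0 = 1], a zero-sum subsequence contains [v ord0] at most once, and by
    [circuit_pos_size] its size is then 0 or the full length. *)
Lemma circuit_seq_min : min_zero_sum circuit_seq.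
Proof.
split; [exact: circuit_seq_neq0 | exact: sum_circuit_seq | move=> s1 s2 s12 sum1].
have s1mem g : g \in s1 -> g \in circuit_seq.
  by move=> gs; rewrite (perm_mem s12) mem_cat gs.
have s1v : {in s1, forall g, circuit_supp g} by move=> g /s1mem/circuit_seq_supp.
have s1neg j : count_mem (- v j)%R s1 = 0%N.
  have := count_circuit_seqN j; rewrite (seq.permP s12) count_cat => /eqP.
  by rewrite addn_eq0 => /andP[/eqP].
have := circuit_pos_size s1v sum1 s1neg.
have : (count_mem (v ord0) s1 <= 1)%N.
  have := count_circuit_seq ord0; rewrite (seq.permP s12) count_cat.
  by case: v_circuit => -> _ _ <-; exact: leq_addr.
have := perm_size s12; rewrite size_cat size_circuit_seq.
case: (count_mem _ s1) => [|[|//]] ss _; rewrite ?mul0n ?mul1n => s1E.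
  by left; apply: size0nil.
right; apply: size0nil; move: ss; rewrite s1E -{1}[circuit_length]addn0.
by move=> /addnI/esym.
Qed.

(** The excesses are a positive multiple of [c]; without opposite pairs they are plain
    multiplicities, so [s] contains [circuit_seq] and equals it by minimality. *)
Lemma circuit_min_pos s : min_zero_sum s -> {in s, forall g, circuit_supp g} ->
  (0 < excess ord0 s)%R -> (forall j, (v j \notin s) || ((- v j)%R \notin s)) ->
  size s = circuit_length /\ excess ord0 s = 1%R.
Proof.
move=> smin sv spos nopair; have sum_s : (\sum_(g <- s) g = 0)%R by case: smin.
have cle j : (c j <= count_mem (v j) s)%N.
  have := circuit_excess j sv sum_s; rewrite {1}/excess.
  case: v_circuit => _ /(_ j) cj _; case/orP: (nopair j) => /count_memPn->.
    by move: (excess _ _) spos (count_mem _ _) => x; nia.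
  by move: (excess _ _) spos => x; rewrite subr0; nia.
have sE : perm_eq s circuit_seq.
  apply: min_zero_sum_sub => //; [exact: circuit_seq_neq0| |exact: sum_circuit_seq].
  move=> g; have [/mem_circuit_seq[j ->]|/count_memPn->//] := boolP (g \in circuit_seq).
  by rewrite count_circuit_seq.
rewrite (perm_size sE) size_circuit_seq (perm_excess _ sE); split=> //.
by rewrite /excess count_circuit_seq count_circuit_seqN; case: v_circuit => ->.
Qed.

(** Up to order [s] is an opposite pair, the circuit or its negative. Without opposite pairs, the
    sign of the excess decides; excess 0 would make [s] empty. *)
Lemma circuit_min s : min_zero_sum s -> {in s, forall g, circuit_supp g} ->
  (size s = 2 /\ excess ord0 s = 0%R) \/
  (size s = circuit_length /\ (excess ord0 s = 1%R \/ excess ord0 s = (-1)%R)).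
Proof.
move=> smin sv.
have [/existsP[j /andP[js njs]]|nopair] := boolP [exists j, (v j \in s) && ((- v j)%R \in s)].
  have sE := min_zero_sum_opp_in smin js njs (circuit_opp j j).
  left; rewrite (perm_size sE) (perm_excess _ sE); split=> //.
  rewrite /excess /= eqr_opp (negbTE (circuit_opp j ord0)).
  by rewrite [X in nat_of_bool X + 0]eq_sym (negbTE (circuit_opp ord0 j)) !addn0 subrr.
have {}nopair j : (v j \notin s) || ((- v j)%R \notin s).
  by move: nopair; rewrite negb_exists => /forallP/(_ j); rewrite negb_and.
have sum_s : (\sum_(g <- s) g = 0)%R by case: smin.
case: (ltrgtP 0%R (excess ord0 s)) => [spos|sneg|s0]; right.
- by have [-> ->] := circuit_min_pos smin sv spos nopair; split; [|left].
- have [||||sE tE] := circuit_min_pos (s := map -%R%R s).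
  + exact: min_zero_sum_opp.
  + move=> _ /mapP[g /sv[j gE] ->]; exists j.
    by case: gE => ->; rewrite ?opprK; [right|left].
  + by rewrite excess_opp oppr_gt0.
  + move=> j; rewrite (mem_map oppr_inj) -{1}[v j]opprK (mem_map oppr_inj) orbC.
    exact: nopair.
  + move: sE tE; rewrite size_map excess_opp => -> tE; split=> //; right.
    by rewrite -tE opprK.
- have [_ size_s] := circuit_supp_sum sv; case: smin => + _ _; case.
  apply: size0nil; rewrite size_s big1 // => j _.
  have := circuit_excess j sv sum_s; rewrite -s0 mul0r /excess.
  by case/orP: (nopair j) => /count_memPn->; lia.
Qed.

(** [T] counts the members of length [circuit_length] in the second case of [circuit_min], and [K]
    those among them of excess -1. The excess of the whole thus fixes the parity of [T]. *)
Lemma circuit_flatten (ss : seq (seq G)) :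
  {in ss, forall s, min_zero_sum s /\ {in s, forall g, circuit_supp g}} ->
  exists T K : nat, size (flatten ss) = (2 * size ss + (circuit_length - 2) * T)%N /\
    (T%:Z = excess ord0 (flatten ss) + 2%:Z * K%:Z)%R.
Proof.
elim: ss => [|s ss IHss] ssP; first by exists 0%N, 0%N; rewrite muln0.
have [|T [K [sT TK]]] := IHss; first by move=> t ts; apply: ssP; rewrite inE ts orbT.
have [smin sv] := ssP s (mem_head _ _).
rewrite /= size_cat excess_cat sT.
have [[-> ->]|[-> [->|->]]] := circuit_min smin sv.
- by exists T, K; rewrite TK; split; lia.
- by exists T.+1, K; rewrite mulnS; split; lia.
- by exists T.+1, K.+1; rewrite mulnS; split; lia.
Qed.

End Circuit.

(* The system [a_(i+1) = \sum_(j <= i | N i j) a_j] is unit triangular; it is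
   realized by 0-1 vectors up to a global sign as long as [a_(i+1)] and the
   [a_j] on the right-hand side carry opposite signs. *)
Lemma triangular_circuit (G : zmodType) (r : nat) (e : 'I_r -> G) (n : nat)
    (sg : nat -> bool) (N : nat -> nat -> bool) (c : nat -> nat) :
  (forall b : 'I_r -> int, (\sum_i e i *~ b i = 0)%R -> forall i, b i = 0%R) ->
  (n <= r)%N ->
  (forall i j, (i < n)%N -> (j <= i)%N -> N i j -> sg j != sg i.+1) ->
  c 0%N = 1%N -> (forall j, (j <= n)%N -> (0 < c j)%N) ->
  (forall i, (i < n)%N -> c i.+1 = (\sum_(0 <= j < i.+1 | N i j) c j)%N) ->
  exists2 v : 'I_n.+1 -> G, circuit v (fun j => c j) &
    forall j, (Gplus e `|` Gminus e) (v j).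
Proof.
move=> indep nr sgN c0 cpos cE.
(* Row [i] marks the indices occurring in the equation for [a_(i+1)]; rows from [n] on vanish, since
   [n] may be smaller than [r]. *)
pose T (i j : nat) := (i < n)%N && ((j == i.+1) || (j <= i)%N && N i j).
pose w (j : nat) : G := (\sum_(i < r) e i *+ T i j)%R.
pose v (j : 'I_n.+1) : G := if sg j then (- w j)%R else w j.
pose sgz (j : nat) (x : int) : int := if sg j then (- x)%R else x.
exists v; last first.
  move=> j; rewrite /v; have wP : Gplus e (w j) by exists (fun i => T i j).
  by case: (sg j); [right; exists (w j) | left].
split=> //; first by move=> j; apply: cpos; rewrite -ltnS.
move=> a; pose b (k : nat) : int := a (inord k).
have aE (j : 'I_n.+1) : a j = b j by rewrite /b inord_val.
have vE : (\sum_j v j *~ a j =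
    \sum_(i < r) e i *~ (\sum_(0 <= j < n.+1) sgz j (b j) *+ T i j))%R.
  rewrite (eq_bigr (fun j : 'I_n.+1 => \sum_(i < r) e i *~ (sgz j (b j) *+ T i j))%R).
    rewrite exchange_big /=; apply: eq_bigr => i _.
    by rewrite big_mkord (raddf_sum (intmul (e i))).
  move=> j _; rewrite aE /v /sgz; case: (sg j).
    rewrite mulNrz -mulrNz /w mulrz_suml; apply: eq_bigr => i _.
    by case: (T i j); rewrite ?mulr1n // !mulr0n mulr0z mul0rz.
  rewrite /w mulrz_suml; apply: eq_bigr => i _.
  by case: (T i j); rewrite ?mulr1n // !mulr0n mulr0z mul0rz.
(* By [sgN] the terms with [j <= i] carry the sign opposite to that of [i.+1], so a row is, up to
   sign, the difference of the two sides of its equation. *)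
have rowE i : (i < n)%N -> (\sum_(0 <= j < n.+1) sgz j (b j) *+ T i j =
    sgz i.+1 (b i.+1 - \sum_(0 <= j < i.+1 | N i j) b j))%R.
  move=> lt_in; rewrite (@big_cat_nat _ _ _ i.+1) //=; last by lia.
  have Tii : T i i.+1 by rewrite /T lt_in eqxx.
  rewrite [X in (_ + X)%R]big_ltn // Tii mulr1n.
  rewrite [X in (_ + (_ + X))%R]big1_seq ?addr0; last first.
    move=> j /=; rewrite mem_index_iota => /andP[ij _]; rewrite /T lt_in.
    by have /negbTE-> : j != i.+1; [lia | rewrite (_ : (j <= i)%N = false) //; lia].
  have -> : (\sum_(0 <= j < i.+1) sgz j (b j) *+ T i j =
      sgz i.+1 (- \sum_(0 <= j < i.+1 | N i j) b j))%R.
    rewrite /sgz [in RHS]big_mkcond /=.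
    have -> (x : int) : (if sg i.+1 then - - x else - x)%R = ((if sg i.+1 then 1 else -1) * x)%R.
      by case: (sg _); rewrite ?opprK ?mul1r ?mulN1r.
    rewrite mulr_sumr; apply: eq_big_nat => j /andP[_ ji]; rewrite /T lt_in /=.
    have /negbTE-> : j != i.+1 by lia.
    rewrite -ltnS ji /=; case Nij: (N i j); last by rewrite mulr0n mulr0.
    have := sgN i j lt_in ji Nij; rewrite mulr1n.
    by case: (sg j); case: (sg i.+1) => // _; rewrite ?mul1r ?mulN1r.
  by rewrite /sgz; case: (sg _); rewrite ?opprB ?opprK addrC.
have rec_iff : (\sum_j v j *~ a j = 0)%R <->
    forall i, (i < n)%N -> (b i.+1 = \sum_(0 <= j < i.+1 | N i j) b j)%R.
  rewrite vE; split=> [/indep H i lt_in|H].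
    have := H (Ordinal (leq_trans lt_in nr)); rewrite /= rowE // /sgz => /eqP.
    by case: (sg _); rewrite ?oppr_eq0 subr_eq0 => /eqP.
  rewrite big1 // => i _; have [lt_in|le_ni] := ltnP i n.
    by rewrite rowE // H // subrr /sgz; case: (sg _); rewrite ?oppr0 mulr0z.
  rewrite big1 ?mulr0z // => j _.
  by rewrite /T ltnNge le_ni /= mulr0n.
have cZ i : (i < n)%N -> ((c i.+1)%:Z = \sum_(0 <= j < i.+1 | N i j) (c j)%:Z)%R.
  by move=> /cE->; rewrite (big_morph Posz PoszD (erefl _)).
rewrite rec_iff; split=> [H j|H i lt_in].
  suff K k : (k <= n)%N -> b k = (b 0%N * (c k)%:Z)%R.
    by rewrite !aE K // -ltnS.
  elim/ltn_ind: k => -[|k] IHk kn; first by rewrite c0 mulr1.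
  rewrite H // cZ // mulr_sumr [LHS]big_nat_cond [RHS]big_nat_cond.
  apply: eq_bigr => j' /andP[/andP[_ jk] _].
  by apply: IHk => //; lia.
have bE k : (k <= n)%N -> b k = (b 0%N * (c k)%:Z)%R.
  by move=> kn; have := H (inord k); rewrite !aE inordK.
rewrite bE // cZ // mulr_sumr [LHS]big_nat_cond [RHS]big_nat_cond.
apply: eq_bigr => j /andP[/andP[_ jk] _].
by rewrite [RHS]bE //; lia.
Qed.

(** * The Fibonacci circuit and the circuits with all but one coefficient 1 *)

Section Examples.
Variables (G : zmodType) (r : nat) (e : 'I_r -> G).
Hypothesis indep :
  forall b : 'I_r -> int, (\sum_i e i *~ b i = 0)%R -> forall i, b i = 0%R.

(** The value 1 at 0 meets the normalization of circuits and supplies the extra 1 in the identity 1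
    + F_1 + ... + F_n = F_(n+2). *)
Definition fib1 (j : nat) := if j is 0 then 1%N else fib j.

Lemma fibSS n : fib n.+2 = (fib n.+1 + fib n)%N. Proof. by []. Qed.

Lemma fib_gt0 n : (0 < fib n.+1)%N.
Proof. by elim: n => // n IHn; rewrite fibSS ltn_addr. Qed.

Lemma fib1_gt0 n : (0 < fib1 n)%N.
Proof. by case: n => // n; exact: fib_gt0. Qed.

(** Of the two top indices exactly one has the right parity; removing both leaves the sum for
    [i - 2], and the Fibonacci recursion applies. Opposite parities are what the alternating signs
    in [fib_circuit] require. *)
Lemma fib1_odd_sum i :
  fib1 i.+1 = (\sum_(0 <= j < i.+1 | odd (i.+1 + j)) fib1 j)%N.
Proof.
have [n] := ubnP i; elim: n i => // n IHn [|[|i]] lin.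
- by rewrite big_mkcond /= big_nat1.
- by rewrite big_mkcond /= !big_nat_recr //= big_nil.
rewrite big_mkcond big_nat_recr //= big_nat_recr //= -big_mkcond /=.
rewrite (eq_bigl (fun j => odd (i.+1 + j))); last first.
  by move=> j; rewrite !addSn /= !negbK.
have parity : odd (i + i.+2) = false /\ odd (i + i.+1) = true.
  by rewrite !addnS /= negbK addnn odd_double.
rewrite -(IHn i); last by lia.
by case: parity => -> -> /=; rewrite addn0 addnC.
Qed.

Lemma fib1_sum n : (\sum_(j < n.+1) fib1 j = fib n.+2)%N.
Proof.
elim: n => [|n IHn]; first by rewrite big_ord_recr big_ord0.
by rewrite big_ord_recr /= IHn addnC.
Qed.

Lemma fib_circuit : exists2 v : 'I_r.+1 -> G, circuit v (fun j => fib1 j) &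
  forall j, (Gplus e `|` Gminus e) (v j).
Proof.
apply: (@triangular_circuit _ r e r odd (fun i j => odd (i.+1 + j)) fib1) => //.
- by move=> i j _ _; rewrite oddD; case: (odd j); case: (odd i.+1).
- by move=> j _; exact: fib1_gt0.
- by move=> i _; exact: fib1_odd_sum.
Qed.

(** The system is [a_(i+1) = a_0] for [i < m] and [a_(m+1) = a_1 + ... + a_k], with solution
    [(1, ..., 1, k)]. The indices from 1 to [m] carry one sign, 0 and [m+1] the other. *)
Lemma short_circuit m k : (0 < k <= m)%N -> (m < r)%N ->
  exists (v : 'I_m.+2 -> G) (c : 'I_m.+2 -> nat),
    [/\ circuit v c, circuit_length c = (m + k).+1 &
        forall j, (Gplus e `|` Gminus e) (v j)].
Proof.
move=> /andP[k0 km] mr; pose c (j : nat) := if (j <= m)%N then 1%N else k.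
have [||||v vc vP] := @triangular_circuit _ r e m.+1 (fun j => (0 < j <= m)%N)
  (fun i j => if (i < m)%N then j == 0%N else (0 < j <= k)%N) c indep mr.
- by move=> i j; rewrite !ltnS => im ji; case: ltnP => [im'|im'] H; lia.
- by [].
- by move=> j _; rewrite /c; case: ifP.
- move=> i; rewrite ltnS leq_eqVlt => /predU1P[->|im].
    rewrite ltnn /c ltnn big_mkcond big_ltn //= add0n.
    rewrite (@big_cat_nat _ _ _ k.+1) //= -!big_mkcond /=.
    rewrite [X in (_ + X)%N]big1_seq; last by move=> j; rewrite mem_index_iota; lia.
    rewrite addn0 big_mkcond (eq_big_nat _ _ (F2 := fun=> 1%N)).
      by rewrite sum_nat_const_nat muln1 subn1.
    by move=> j /andP[j0 jk]; rewrite j0 -ltnS jk (leq_trans _ km).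
  rewrite im /c im big_mkcond big_ltn //= big1_seq ?addn0 // => j /=.
  by rewrite mem_index_iota => /andP[j0 _]; rewrite gtn_eqF.
exists v, (fun j => c j); split=> //.
rewrite /circuit_length big_ord_recr /= /c ltnn.
rewrite (eq_bigr (fun=> 1%N)); last by move=> j _; rewrite -ltnS ltn_ord.
by rewrite sum_nat_const card_ord muln1 addSn.
Qed.

End Examples.

(** * Minimal distances and the theorem *)

Section CircuitModel.
Variables (M : ccMonoidType) (P : choiceType) (G : zmodType).
Variables (cl : P -> G) (phi : M -> {mset P}).
Hypothesis phiP : zero_sum_model cl setT phi.
Variables (n : nat) (v : 'I_n.+1 -> G) (c : 'I_n.+1 -> nat).
Hypotheses (v_circuit : circuit v c) (long : (2 < circuit_length c)%N).
Hypothesis v_range : forall j, range cl (v j).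

Lemma circuit_atom : exists2 u, atom u & perm_eq (map cl (phi u)) (circuit_seq v c).
Proof.
have [|u uE] := model_lift phiP _ (sum_circuit_seq v_circuit long).
  by move=> g /mem_circuit_seq[j ->].
exists u => //; apply/(atom_phi phiP).
by apply: perm_min_zero_sum (circuit_seq_min v_circuit long); rewrite perm_sym.
Qed.

Definition class_supported : {pred M} :=
  fun a => `[< {in phi a, forall p, circuit_supp v (cl p)} >].

Lemma class_supportedM : mulg_closed class_supported.
Proof.
move=> a b /asboolP Sa /asboolP Sb; apply/asboolP => p.
by rewrite (modelM phiP) in_msetD => /orP[/Sa|/Sb].
Qed.

Lemma class_supported1 : 1 \in class_supported.
Proof. by apply/asboolP => p; rewrite (model1 phiP) in_mset0. Qed.

(* All lengths of an element agree modulo [circuit_length c - 2]: passing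
   between factorizations trades an opposite pair of long atoms for
   [circuit_length c] atoms of size 2. *)
Lemma circuit_lengths a m l : a \in class_supported -> lengths a m -> lengths a l ->
  (m < l)%N -> (circuit_length c - 2 <= l - m)%N.
Proof.
move=> /asboolP aS am al ml.
have inv k : lengths a k -> exists T K : nat,
    (size (phi a) = 2 * k + (circuit_length c - 2) * T)%N /\
    (T%:Z = excess v ord0 (map cl (phi a)) + 2%:Z * K%:Z)%R.
  move=> /lengthsP[s [sat <- sa]].
  pose ss := [seq map cl (phi u) | u <- s].
  have ssE : perm_eq (map cl (phi a)) (flatten ss).
    have /(pi_phi phiP) <- := sa; rewrite (model_prod phiP) /ss.
    elim: (s) => [|u s' IHs] /=; first by rewrite big_nil enum_mset0.
    rewrite big_cons; apply: perm_trans (perm_map cl (perm_msetD _ _)) _.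
    by rewrite map_cat perm_cat2l.
  have [|T [K [ssT TK]]] := circuit_flatten v_circuit long (ss := ss).
    move=> _ /mapP[u us ->]; split; first exact/(atom_phi phiP)/sat.
    move=> _ /mapP[p pu ->]; apply: aS.
    have /(pi_phi phiP) <- := sa; have /(phi_dvd phiP) := mdvd_prod us.
    by move/msubset_subset; apply.
  exists T, K; rewrite (perm_excess v ord0 ssE); split=> //.
  by have := perm_size ssE; rewrite size_map ssT size_map.
have [T [K [aT TK]]] := inv m am; have [T' [K' [aT' TK']]] := inv l al.
(* [T] and [T'] both have the parity of the excess of [a], and the longer factorization has at most
   as many long atoms. *)
have [d dE] : exists d, T = (T' + 2 * d)%N.
  have : (T' <= T)%N.
    rewrite leqNgt; apply/negP => TT'; move: aT'; rewrite aT.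
    have := leq_mul (leqnn (circuit_length c - 2)) (ltnW TT'); lia.
  by move=> TT'; exists (K - K')%N; lia.
have QE : ((circuit_length c - 2) * T =
    (circuit_length c - 2) * T' + 2 * ((circuit_length c - 2) * d))%N.
  by rewrite dE mulnDr mulnCA.
move: aT'; rewrite aT QE; case: d {dE QE} => [|d]; first by rewrite muln0; lia.
by rewrite mulnS; move: (circuit_length c - 2)%N (_ * T')%N (_ * d)%N => q x y; lia.
Qed.

Hypothesis cl_opp : forall p, cl p <> 0%R -> exists q, cl q = (- cl p)%R.
Hypothesis no2torsion : forall g : G, (g + g = 0)%R -> g = 0%R.

(** On the elements supported by the classes of [circuit_supp v], distinct lengths differ by at
    least this number. It is attained by [u * u'], with [u] the circuit atom, which has the lengths
    2 and [circuit_length c] and none between. *)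
Lemma circuit_Delta_star : Delta_star M (circuit_length c - 2)%N.
Proof.
pose S : umagmaClosed M := HB.pack class_supported
  (isMulClosed.Build M class_supported class_supportedM)
  (isMul1Closed.Build M class_supported class_supported1).
have Sdiv : divisor_closed S.
  move=> a b /asboolP Sb /(phi_dvd phiP)/msubset_subset ab.
  by apply/asboolP => p /ab/Sb.
exists S; split=> //; split; last first.
  move=> d [_ [a _ <-] [k [l [ak al kl -> _]]]].
  move: ak al; rewrite !(lengths_val Sdiv) => ak al.
  by apply: circuit_lengths ak al kl; exact: (valP a).
have [u uat uE] := circuit_atom.
have uC : size (phi u) = circuit_length c.
  by rewrite -(size_circuit_seq v) -(perm_size uE) size_map.
have u2 : (2 < size (phi u))%N by rewrite uC.
have [u' [u'at u'cl L2 LC]] := lengths_atom_opp phiP cl_opp no2torsion uat u2.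
have ucl : {in phi u, forall p, exists j, cl p = v j}.
  by move=> p pu; apply: (@mem_circuit_seq _ _ v c); rewrite -(perm_mem uE) map_f.
have Suu' : u * u' \in S.
  apply/asboolP => p; rewrite (modelM phiP) in_msetD => /orP[/ucl[j ->]|].
    by exists j; left.
  by move=> /u'cl[q /ucl[j qE] ->]; exists j; right; rewrite qE.
exists (lengths (Submonoid Suu')); first by exists (Submonoid Suu').
exists 2, (circuit_length c); rewrite (lengths_val Sdiv) /=; split=> //.
  by rewrite -uC.
move=> m Lm; apply/negP => /andP[m2 mC].
by have := circuit_lengths Suu' L2 Lm m2; lia.
Qed.

End CircuitModel.

(** * Krull monoids as zero-sum models *)

Section Krull.
Variables (H : ccMonoidType) (P : choiceType) (phi : UMagmaMorphism.type H {mset P}).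

Lemma coeff_mset_freeg (z : {mset P}) p : coeff p (mset_freeg z) = (z p)%:Z%R.
Proof.
rewrite /mset_freeg raddf_sum /= -count_mem_mset.
elim: (enum_mset z) => [|q s IHs]; first by rewrite big_nil.
by rewrite big_cons IHs coeffU mul1r /= PoszD natz.
Qed.

(** If the classes in [z] sum to zero, then [z] is a difference of images in the free group, so
    [phi a] is the product of [phi b] and [z]. Hence [b] divides [a], and the quotient maps to
    [z]. *)
Lemma krull_model : divisor_theory phi -> zero_sum_model (prime_class phi) setT phi.
Proof.
move=> [phi_dvd _]; split.
- exact: gmulf1.
- exact: gmulfM.
- by move=> a b /mset_dvdP; exact: phi_dvd.
move=> z.
have sumE : (\sum_(p <- z) prime_class phi p = \pi_(class_group phi) (mset_freeg z))%R.
  by rewrite /mset_freeg raddf_sum.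
have piE : (\pi_(class_group phi) (mset_freeg z) = 0)%R <-> mset_freeg z \in principal phi.
  have -> : (0 = \pi_(class_group phi) 0 :> class_group phi)%R by rewrite raddf0.
  by rewrite -[X in X \in _]subr0 Quotient.idealrBE; split=> [->|/eqP].
split=> [[a aE]|[_]].
  split=> //; rewrite sumE; apply/piE/asboolP; exists a, 1.
  by rewrite aE gmulf1 [X in (_ - X)%R]/mset_freeg enum_mset0 big_nil subr0.
rewrite sumE => /piE/asboolP[a [b zab]].
have aE : phi a = (phi b `+` z)%mset.
  apply/msetP => p; rewrite msetE2; have := congr1 (coeff p) zab.
  rewrite raddfB /= !coeff_mset_freeg; lia.
have [|d dE] := phi_dvd b a; first by rewrite aE; exists z.
exists d; move: aE; rewrite dE gmulfM => /(congr1 (msetB^~ (phi b))).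
by rewrite [(phi b * phi d)%g]/(msetD _ _) !msetDKB.
Qed.

End Krull.

(** * Independence and absence of 2-torsion from a basis *)

Section Basis.
Variables (G : zmodType) (r : nat) (e : 'I_r -> G).
Hypothesis e_basis : zbasis e.

Lemma zbasis_indep (b : 'I_r -> int) :
  (\sum_i e i *~ b i = 0)%R -> forall i, b i = 0%R.
Proof.
move=> b0 i; have [c [_ cuniq]] := e_basis 0%R.
have -> : b i = finfun b i by rewrite ffunE.
rewrite -(cuniq (finfun b)); last by rewrite -[LHS]b0; apply: eq_bigr => j _; rewrite ffunE.
rewrite (cuniq (finfun (fun=> 0%R))) ?ffunE //.
by rewrite big1 // => j _; rewrite ffunE mulr0z.
Qed.

Lemma zbasis_no2torsion (g : G) : (g + g = 0)%R -> g = 0%R.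
Proof.
have [c [-> _]] := e_basis g; rewrite -big_split /= => cc0.
rewrite big1 // => i _; have : (c i + c i = 0)%R.
  apply: (zbasis_indep (b := fun i => (c i + c i)%R)); rewrite -[RHS]cc0.
  by apply: eq_bigr => j _; rewrite mulrzDr.
by move=> ci; have -> : c i = 0%R by [lia]; rewrite mulr0z.
Qed.

Lemma Gplus_minus_opp (g : G) :
  (Gplus e `|` Gminus e) g -> (Gplus e `|` Gminus e) (- g)%R.
Proof. by move=> [gp|[h hp <-]]; [right; exists g | left; rewrite opprK]. Qed.

End Basis.

Local Close Scope group_scope.
Local Close Scope quotient_scope.

Theorem theorem6p7 (R : realType) (H : ccMonoidType) (P : choiceType)
    (phi : UMagmaMorphism.type H {mset P}) (phi_div : divisor_theory phi)
    (r : nat) (r_ge3 : (3 <= r)%N)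
    (e : 'I_r -> class_group phi) (e_basis : zbasis e)
    (GP_eq : prime_classes phi `\ 0%R = (Gplus e `|` Gminus e) `\ 0%R) :
  let D : \bar R := davenport (prime_classes phi) R in
  let c : \bar R := catenary_degree H R in
  [/\ (nat_ereal R (fib (r + 2)) <= D)%E,
      [/\ (c <= omega H R)%E,
          omega H R = D,
          elasticity H R = (D * (2^-1)%:E)%E &
          forall k : nat, (0 < k)%N ->
            rho_k H R (2 * k) = (nat_ereal R k * D)%E] &
      [/\ [set d | (1 <= d <= 2 * r - 3)%N] `<=` Delta_star H,
          Delta_star H `<=` Delta H &
          Delta H `<=` [set d | (1 <= d)%N /\
                                (nat_ereal R d <= c - nat_ereal R 2)%E]]].
Proof.
move=> D c; have phiP := krull_model phi_div.
have indep := zbasis_indep e_basis.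
have no2torsion := zbasis_no2torsion e_basis.
(* Whether 0 is the class of a prime is left open by [GP_eq]; the vectors of a circuit are nonzero
   by [circuit_neq0]. *)
have range_cl g : (Gplus e `|` Gminus e) g -> g <> 0%R -> range (prime_class phi) g.
  by move=> gP g0; have [] : (prime_classes phi `\ 0%R) g by rewrite GP_eq.
have cl_opp p : prime_class phi p <> 0%R ->
    exists q, prime_class phi q = (- prime_class phi p)%R.
  move=> p0; have [gP _] : ((Gplus e `|` Gminus e) `\ 0%R) (prime_class phi p).
    by rewrite -GP_eq; split=> //; exists p.
  have [|q _ <-] := range_cl _ (Gplus_minus_opp gP); last by exists q.
  by move/eqP; rewrite oppr_eq0 => /eqP.
have [v v_circuit vP] := fib_circuit indep.
have len_fib : circuit_length (fun j : 'I_r.+1 => fib1 j) = fib (r + 2).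
  by rewrite /circuit_length fib1_sum addn2.
have long : (2 < circuit_length (fun j : 'I_r.+1 => fib1 j))%N.
  rewrite len_fib addn2; case: (r) r_ge3 => [|[|[|k]]] // _.
  by rewrite !fibSS; have := fib_gt0 k; lia.
have v_range j : range (prime_class phi) (v j).
  by apply: range_cl => //; exact: (circuit_neq0 v_circuit long).
(* The Fibonacci atom serves twice: its length is the lower bound for [D], and it is the atom with
   more than two primes that the invariants call for. *)
have [u0 u0_atom u0E] := circuit_atom phiP v_circuit long v_range.
have u0_size : size (phi u0 : {mset P}) = fib (r + 2).
  by rewrite -len_fib -(size_circuit_seq v) -(perm_size u0E) size_map.
have u0_long : (2 < size (phi u0 : {mset P}))%N by rewrite u0_size -len_fib.
have omegaE := omega_davenport phiP cl_opp no2torsion R u0_atom u0_long.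
split.
- rewrite /D (davenportE phiP) -u0_size; apply: esup0_ubound; by exists u0.
- split.
  + by rewrite omegaE; exact: (catenary_le_davenport phiP R u0_atom u0_long).
  + exact: omegaE.
  + exact: (elasticity_davenport phiP cl_opp no2torsion R u0_atom u0_long).
  + exact: (rho_davenport phiP cl_opp no2torsion R u0_atom u0_long).
split; [|exact: Delta_star_Delta|by move=> d; exact: Delta_catenary].
move=> d /= d_le.
(* The two halves of [d + 1], rounded up and down, satisfy [m + k = d + 1], so the circuit has
   length [d + 2]; the bound [d <= 2 * r - 3] is what gives [m < r]. *)
have [|| w [cw [w_circuit len_w wP]]] :=
  short_circuit indep (m := uphalf d.+1) (k := d.+1./2).
- by have := uphalf_half d.+1; lia.
- by have := uphalf_half d.+1; lia.
have len_d : circuit_length cw = d.+2.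
  by rewrite len_w; have := uphalf_half d.+1; lia.
have w_long : (2 < circuit_length cw)%N by lia.
have -> : d = (circuit_length cw - 2)%N by lia.
apply: (circuit_Delta_star phiP w_circuit w_long _ cl_opp no2torsion) => j.
by apply: range_cl => //; exact: (circuit_neq0 w_circuit w_long).
Qed.
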